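(* Let $(\mathbb{L},\mu)$ be a random iterated function system on $\mathbb{R}^d$ (with index set $\Lambda$) which is non-extinguishing, i.e. $\int_\Lambda \mathcal{N}(\lambda)\,d\mu(\lambda)>1$, which satisfies the uniform open set condition, and all of whose maps $f_\lambda^i$ are similarities with contraction rates $c_\lambda^i$ satisfying $c_{\min}\le c_\lambda^i\le c_{\max}$ for all $\lambda\in\Lambda\setminus\{0\}$, $1\le i\le\mathcal{N}(\lambda)$, for some constants $0<c_{\min}\le c_{\max}<1$. Additionally, assume that $\mu(\{0\})=0$. Let $\mathbb{P}_1$ be the random homogeneous ($1$-variable) measure on the space $\mathcal{T}$ of labelled trees and let $F_\tau$ be the set associated with $\tau\in\mathcal{T}$. Then, for $\mathbb{P}_1$-almost every $\tau\in\mathcal{T}$, $$\dim_{qA}F_\tau=\dim_H F_\tau ,$$ where $\dim_{qA}$ is the quasi-Assouad dimension and $\dim_H$ is the Hausdorff dimension.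
   Context: **Random iterated function systems.** Let $\Lambda\subset\mathbb{R}^k$ be compact (for some $k$) and let $\mu$ be a Borel probability measure on $\Lambda$. Fix $\mathcal{N}\in\mathbb{N}$. For each $\lambda\in\Lambda$ there is a finite iterated function system (IFS) $\mathbb{I}_\lambda=\{f_\lambda^1,\dots,f_\lambda^{\mathcal{N}(\lambda)}\}$ of maps $f_\lambda^i:\mathbb{R}^d\to\mathbb{R}^d$, with $\mathcal{N}(\lambda)\le\mathcal{N}$. If $0\in\Lambda$, then $0$ is an isolated point of $\Lambda$ and $\mathbb{I}_0=\varnothing$ (so $\mathcal{N}(0)=0$); for all $\lambda\in\Lambda\setminus\{0\}$ one has $\mathcal{N}(\lambda)\ge1$. The map $\lambda\mapsto\mathcal{N}(\lambda)$ and the dependence of $f_\lambda^i$ on $\lambda$ are Borel measurable. Put $\mathbb{L}=\{\mathbb{I}_\lambda\}_{\lambda\in\Lambda}$; the pair $(\mathbb{L},\mu)$ is a random iterated function system (RIFS). A similarity with contraction rate $c$ is a map $f$ with $\|f(x)-f(y)\|=c\|x-y\|$ for all $x,y$ (Euclidean norm). **Uniform open set condition (UOSC).** There exists a non-empty bounded open set $\mathcal{O}\subset\mathbb{R}^d$ such that for all $\lambda\in\Lambda\setminus\{0\}$ and all $1\le i,j\le\mathcal{N}(\lambda)$: $f_\lambda^i(\mathcal{O})\subseteq\mathcal{O}$, and $f_\lambda^i(\mathcal{O})\cap f_\lambda^j(\mathcal{O})\ne\varnothing$ implies $i=j$. **Labelled trees and the measure $\mathbb{P}_1$.** Let $\mathfrak{T}=\bigcup_{k\ge0}\{1,\dots,\mathcal{N}\}^k$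 be the set of nodes of the rooted $\mathcal{N}$-ary tree (the root is the empty tuple), and let $\mathcal{T}=\Lambda^{\mathfrak{T}}$ be the set of labellings $\tau:\mathfrak{T}\to\Lambda$. Let $\mathcal{T}_1\subset\mathcal{T}$ be the set of $\tau$ for which $\tau(v)=\tau(w)$ whenever $v,w$ are nodes of the same level. The measure $\mathbb{P}_1$ is the probability measure supported on $\mathcal{T}_1$ under which the common labels of the levels $0,1,2,\dots$ are independent with law $\mu$; that is, for finite sets $L$ of levels and open $O(l)\subseteq\Lambda$ ($l\in L$), $\mathbb{P}_1\{\tau\in\mathcal{T}_1\mid \text{the level-}l\text{ label lies in }O(l)\ \forall l\in L\}=\prod_{l\in L}\mu(O(l))$. **The set $F_\tau$.** For $\tau\in\mathcal{T}$, a node $v=(v_1,\dots,v_k)$ is called admissible if $v_{j+1}\le\mathcal{N}(\tau((v_1,\dots,v_j)))$ for all $0\le j<k$; for admissible $v$ put $$f_v=f_{\tau(\text{root})}^{v_1}\circ f_{\tau((v_1))}^{v_2}\circ\cdots\circ f_{\tau((v_1,\dots,v_{k-1}))}^{v_k}.$$ Then $F_\tau=\bigcap_{k=1}^\infty\ \bigcup_{v\text{ admissible of level }k} f_v(\Delta)$, where $\Delta\subset\mathbb{R}^d$ is a non-empty compact set with $f_\lambda^i(\Delta)\subseteq\Delta$ for all $\lambda\in\Lambda$, $1\le i\le\mathcal{N}(\lambda)$ (e.g. the closure of $\mathcal{O}$); $F_\tau$ is compact and does not depend on the choice of $\Delta$. **Quasi-Assouad dimension.** For a totally bounded metric space $F$,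 $|F|$ denotes its diameter; $N_r(X)$ is the minimal number of sets of diameter at most $r$ needed to cover $X$; $N_{r,R}(F)=\max_{x\in F}N_r(B(x,R)\cap F)$, with $B(x,R)$ the open ball. For $\delta\ge0$, $$h(\delta,F)=\inf\{\alpha\ge 0\mid \exists C>0,\ \forall\, 0<r\le R^{1+\delta}\le|F|:\ N_{r,R}(F)\le C(R/r)^\alpha\},$$ and $\dim_{qA}F=\lim_{\delta\to0^+}h(\delta,F)$. *)

(* Defs.v *)
From HB Require Import structures.
From mathcomp Require Import all_boot all_order all_algebra.
From mathcomp Require Import finmap.
From mathcomp Require Import all_classical all_reals all_analysis.
Import numFieldNormedType.Exports.

Set Implicit Arguments.
Unset Strict Implicit.
Unset Printing Implicit Defensive.

Import Order.TTheory GRing.Theory Num.Theory.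
Local Open Scope classical_set_scope.
Local Open Scope ring_scope.

(* The norm of the library on ['rV[R]_d] is the sup norm. It has the same
   topology, hence the same open, bounded and compact sets, as the Euclidean
   norm, but similarities, balls and diameters need the Euclidean norm. *)
Definition enorm (R : realType) (d : nat) (x : 'rV[R]_d) : R :=
  Num.sqrt (\sum_(i < d) x 0 i ^+ 2).

Definition eball (R : realType) (d : nat) (x : 'rV[R]_d) (r : R) :
    set 'rV[R]_d :=
  [set y | enorm (x - y) < r].

(* [maxe 0] only serves to give the empty set diameter 0 instead of -oo. *)
Definition diam (R : realType) (d : nat) (A : set 'rV[R]_d) : \bar R :=
  maxe 0%E (ereal_sup [set (enorm (p.1 - p.2))%:E | p in A `*` A]).

Definition is_similarity (R : realType) (d : nat) (f : 'rV[R]_d -> 'rV[R]_d)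
    (c : R) : Prop :=
  forall x y, enorm (f x - f y) = c * enorm (x - y).

(* The convention is [0 `^ 0 = 1] for non-empty sets of diameter 0; the empty
   set does not contribute, even for [s = 0]. *)
Definition hausdorff_gauge (R : realType) (d : nat) (s : R) (A : set 'rV[R]_d) :
    \bar R :=
  if `[< A = set0 >] then 0%E else poweR (diam A) s.

Definition hausdorff_premeasure (R : realType) (d : nat) (s e : R)
    (F : set 'rV[R]_d) : \bar R :=
  ereal_inf [set (\sum_(0 <= i <oo) hausdorff_gauge s (U i))%E |
    U in [set U : nat -> set 'rV[R]_d |
      F `<=` \bigcup_i U i /\ forall i, (diam (U i) <= e%:E)%E]].

Definition hausdorff_measure (R : realType) (d : nat) (s : R)
    (F : set 'rV[R]_d) : \bar R :=
  ereal_sup [set hausdorff_premeasure s e F | e in [set e : R | 0 < e]].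

Definition dim_H (R : realType) (d : nat) (F : set 'rV[R]_d) : \bar R :=
  ereal_inf [set s%:E | s in
    [set s : R | 0 <= s /\ hausdorff_measure s F = 0%E]].

Definition cover_number (R : realType) (d : nat) (r : R)
    (X : set 'rV[R]_d) : \bar R :=
  ereal_inf [set n%:R%:E | n in [set n : nat |
    exists U : 'I_n -> set 'rV[R]_d,
      (forall i, (diam (U i) <= r%:E)%E) /\ X `<=` \bigcup_i U i]].

Definition local_cover_number (R : realType) (d : nat) (r rho : R)
    (F : set 'rV[R]_d) : \bar R :=
  ereal_sup [set cover_number r (eball x rho `&` F) | x in F].

(* [0 < rho] is not redundant: [powR] takes positive values on negative
   arguments. *)
Definition qA_spectrum (R : realType) (d : nat) (delta : R)
    (F : set 'rV[R]_d) : \bar R :=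
  ereal_inf [set a%:E | a in [set a : R | 0 <= a /\
    exists2 C : R, 0 < C & forall r rho : R,
      0 < r -> 0 < rho ->
      r <= rho `^ (1 + delta) -> ((rho `^ (1 + delta))%:E <= diam F)%E ->
      (local_cover_number r rho F <= (C * (rho / r) `^ a)%:E)%E]].

Definition dim_qA (R : realType) (d : nat) (F : set 'rV[R]_d) : \bar R :=
  lim (qA_spectrum delta F @[delta --> 0^'+]).

(* The set [Lam] as a type, with the subspace topology. Measurable types of the
   library are pointed, whence the base point [l0]; it has no other role, and
   it exists as soon as [Lam] carries a probability measure. *)
Definition param_type (R : realType) (k : nat) (Lam : set 'rV[R]_k)
    (l0 : Lam) : Type := Lam.

HB.instance Definition _ (R : realType) (k : nat) (Lam : set 'rV[R]_k)
  (l0 : Lam) := Topological.copy (param_type l0) (set_type Lam).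
HB.instance Definition _ (R : realType) (k : nat) (Lam : set 'rV[R]_k)
  (l0 : Lam) := isPointed.Build (param_type l0) l0.

Notation borel T := (g_sigma_algebraType (@open T)).

Definition param_val (R : realType) (k : nat) (Lam : set 'rV[R]_k) (l0 : Lam)
  (l : param_type l0) : 'rV[R]_k := set_val (l : Lam).

(* Maps are numbered from 0: the system at [l] consists of the [maps l i] with
   [i < nmaps l]; the other values of [maps] are irrelevant. Measurable
   dependence on the parameter means that [l |-> maps l i x] is Borel, for all
   [i] and [x], where it is meaningful. *)
Record rifs (R : realType) (k d M : nat) (Lam : set 'rV[R]_k) (l0 : Lam) :=
  Rifs {
  nmaps : param_type l0 -> nat;
  maps : param_type l0 -> 'I_M -> 'rV[R]_d -> 'rV[R]_d;
  rifs_compact : compact Lam;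
  rifs_isolated : 0 \in Lam -> isolated Lam 0;
  nmaps_le : forall l, (nmaps l <= M)%N;
  nmaps0 : forall l, param_val l = 0 -> nmaps l = 0%N;
  nmaps_gt0 : forall l, param_val l != 0 -> (0 < nmaps l)%N;
  measurable_nmaps :
    measurable_fun [set: borel (param_type l0)]
      (nmaps : borel (param_type l0) -> nat);
  measurable_maps : forall (i : 'I_M) (x : 'rV[R]_d),
    measurable_fun ([set l | (i < nmaps l)%N] : set (borel (param_type l0)))
      ((fun l => maps l i x) : borel (param_type l0) -> borel 'rV[R]_d)
}.

Definition uosc (R : realType) (k d M : nat) (Lam : set 'rV[R]_k) (l0 : Lam)
    (I : rifs d M l0) : Prop :=
  exists O : set 'rV[R]_d,
    [/\ O !=set0, open O, (diam O < +oo)%E &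
      forall l, param_val l != 0 ->
        (forall i : 'I_M, (i < nmaps I l)%N -> maps I l i @` O `<=` O) /\
        (forall i j : 'I_M, (i < nmaps I l)%N -> (j < nmaps I l)%N ->
          (maps I l i @` O) `&` (maps I l j @` O) !=set0 -> i = j)].

Notation node M := (seq 'I_M).

Notation labelling M l0 := (node M -> param_type l0).

Definition cylinders (R : realType) (k M : nat) (Lam : set 'rV[R]_k)
    (l0 : Lam) : set (set (labelling M l0)) :=
  [set A | exists v : node M,
    exists2 B : set (param_type l0), open B & A = [set tau | B (tau v)]].

(* The labellings with the product of the Borel sigma-algebras. As [Lam] is
   second countable, it is the Borel sigma-algebra of the product topology. *)
Notation tree M l0 := (g_sigma_algebraType (@cylinders _ _ M _ l0)).

Definition homogeneous (R : realType) (k M : nat) (Lam : set 'rV[R]_k)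
    (l0 : Lam) : set (labelling M l0) :=
  [set tau | forall v w : node M, size v = size w -> tau v = tau w].

(* This determines [P]: the sets on the left-hand side form a pi-system which
   generates the sigma-algebra modulo null sets, and [L = fset0] says that [P]
   is supported on the homogeneous labellings. *)
Definition is_random_homogeneous (R : realType) (k M : nat)
    (Lam : set 'rV[R]_k) (l0 : Lam)
    (mu : probability (borel (param_type l0)) R)
    (P : probability (tree M l0) R) : Prop :=
  forall (L : {fset nat}) (O : nat -> set (param_type l0)),
    (forall n, n \in L -> open (O n)) ->
    P [set tau : labelling M l0 | homogeneous tau /\
        forall v : node M, size v \in L -> O (size v) (tau v)]
    = (\prod_(n <- L) mu (O n))%E.

Definition admissible (R : realType) (k d M : nat) (Lam : set 'rV[R]_k)
    (l0 : Lam) (I : rifs d M l0) (tau : labelling M l0) (v : node M) : Prop :=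
  forall (u : node M) (i : 'I_M) (w : node M),
    v = u ++ i :: w -> (i < nmaps I (tau u))%N.

(* The composition along the path [v] which starts at the node [u]. *)
Fixpoint node_map (R : realType) (k d M : nat) (Lam : set 'rV[R]_k)
    (l0 : Lam) (I : rifs d M l0) (tau : labelling M l0) (u v : node M) :
    'rV[R]_d -> 'rV[R]_d :=
  if v is i :: w then maps I (tau u) i \o node_map I tau (rcons u i) w
  else id.

Definition invariant_compact (R : realType) (k d M : nat)
    (Lam : set 'rV[R]_k) (l0 : Lam) (I : rifs d M l0)
    (Delta : set 'rV[R]_d) : Prop :=
  [/\ Delta !=set0, compact Delta &
    forall l (i : 'I_M), (i < nmaps I l)%N ->
      maps I l i @` Delta `<=` Delta].

Definition attractor (R : realType) (k d M : nat) (Lam : set 'rV[R]_k)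
    (l0 : Lam) (I : rifs d M l0) (Delta : set 'rV[R]_d)
    (tau : labelling M l0) : set 'rV[R]_d :=
  \bigcap_(n in [set n : nat | (0 < n)%N])
    \bigcup_(v in [set v : node M | size v = n /\ admissible I tau v])
      (node_map I tau [::] v @` Delta).

(* Main.v *)
Require Import Defs.
From HB Require Import structures.
From mathcomp Require Import all_boot all_order all_algebra.
From mathcomp Require Import finmap.
From mathcomp Require Import all_classical all_reals all_analysis.
From mathcomp Require Import measurable_realfun ring lra zify.
Import numFieldNormedType.Exports.

Set Implicit Arguments.
Unset Strict Implicit.
Unset Printing Implicit Defensive.

Import Order.TTheory GRing.Theory Num.Theory.
Local Open Scope classical_set_scope.
Local Open Scope ring_scope.

(* Almost surely the labelling is homogeneous, so that the attractor is a
   Moran set driven by an i.i.d. sequence of labels [l_n]. Put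
   [S_n(s) = \sum_i c_{l_n}^i `^ s]. By the strong law of large numbers, a.s.
     for
   all rational [s >= 0] at once, [\sum_(j < n) ln S_j(s) = m(s) n + o(n)] for a
   constant [m(s)].
   If [0 < m(s)], the products of the [S_j(s)] are bounded below, and the mass
   distribution with weights [c_v `^ s / \prod_j S_j(s)] on the words [v]
   shows that [s <= dim_H F]; the open set condition enters through
   the bounded number of cylinders of size [r] which meet a set of diameter [r].
   If [m(s) <= 0], the same weights show that a cylinder of size [rho] contains
   at most [(rho / r) `^ s * exp(eps n + C)] cylinders of size [r], where [n] is
   of order [ln (1 / r)]. As [r <= rho `^ (1 + delta)], [ln (1 / r)] is
   controlled by [ln (rho / r)], so the error is a power [(rho / r) `^ beta]
     with
   [beta] arbitrarily small: the quasi-Assouad dimension is at most [s].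
   Hence [dim_qA F <= s] for every rational [s] above [dim_H F]; the converse
   inequality holds for all compact sets. *)

(** * Euclidean geometry *)

Section Euclidean.
Context (R : realType) (d : nat).
Implicit Types (x y z : 'rV[R]_d).

Let dot x y : R := \sum_(i < d) x 0 i * y 0 i.

Let dotC x y : dot x y = dot y x.
Proof. by apply: eq_bigr => i _; rewrite mulrC. Qed.

Let dotBl x y z : dot (x - y) z = dot x z - dot y z.
Proof.
rewrite /dot -sumrB; apply: eq_bigr => i _.
by rewrite !mxE mulrBl.
Qed.

Let dotBr x y z : dot z (x - y) = dot z x - dot z y.
Proof. by rewrite dotC dotBl ![dot _ z]dotC. Qed.

Let dot_ge0 x : 0 <= dot x x.
Proof. by apply: sumr_ge0 => i _; rewrite -expr2 sqr_ge0. Qed.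

Let enormE x : enorm x = Num.sqrt (dot x x).
Proof. by congr Num.sqrt; apply: eq_bigr => i _; rewrite expr2. Qed.

Let sqr_enorm x : enorm x ^+ 2 = dot x x.
Proof. by rewrite enormE sqr_sqrtr. Qed.

Lemma enorm_ge0 x : 0 <= enorm x.
Proof. exact: sqrtr_ge0. Qed.

Lemma enorm0 : enorm (0 : 'rV[R]_d) = 0.
Proof.
rewrite enormE [dot _ _]big1 ?sqrtr0// => i _.
by rewrite mxE mul0r.
Qed.

Lemma enormN x : enorm (- x) = enorm x.
Proof.
by congr Num.sqrt; apply: eq_bigr => i _; rewrite mxE sqrrN.
Qed.

Lemma enormBC x y : enorm (x - y) = enorm (y - x).
Proof. by rewrite -enormN opprB. Qed.

Lemma coord_le_enorm x (i : 'I_d) : `|x 0 i| <= enorm x.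
Proof.
rewrite -sqrtr_sqr /enorm ler_wsqrtr// (bigD1 i)//= lerDl.
by apply: sumr_ge0 => j _; rewrite sqr_ge0.
Qed.

Lemma enorm_eq0 x : (enorm x == 0) = (x == 0).
Proof.
apply/eqP/eqP => [x0|->]; last exact: enorm0.
apply/rowP => i; rewrite mxE; apply/eqP; rewrite -normr_le0 -x0.
exact: coord_le_enorm.
Qed.

Lemma enorm_le_sum x : enorm x <= \sum_(i < d) `|x 0 i|.
Proof.
have S0 : 0 <= \sum_(i < d) `|x 0 i| by apply: sumr_ge0.
rewrite -(ger0_norm S0) -sqrtr_sqr /enorm ler_wsqrtr//.
rewrite expr2 mulr_suml; apply: ler_sum => i _.
rewrite -real_normK ?num_real// expr2.
by rewrite ler_wpM2l// (bigD1 i)//= lerDl sumr_ge0.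
Qed.

(* Lagrange's identity. *)
Let dot_sqr_le x y : dot x y ^+ 2 <= dot x x * dot y y.
Proof.
rewrite -subr_ge0 -(pmulr_rge0 _ (ltr0Sn R 1)).
suff -> : 2 * (dot x x * dot y y - dot x y ^+ 2) =
    \sum_(i < d) \sum_(j < d) (x 0 i * y 0 j - x 0 j * y 0 i) ^+ 2.
  by do 2!(apply: sumr_ge0 => ? _); rewrite sqr_ge0.
transitivity (\sum_(i < d) \sum_(j < d) (x 0 i * x 0 i * (y 0 j * y 0 j))
  + \sum_(i < d) \sum_(j < d) (y 0 i * y 0 i * (x 0 j * x 0 j))
  - 2 * \sum_(i < d) \sum_(j < d) (x 0 i * y 0 i * (x 0 j * y 0 j))).
  rewrite expr2 /dot !big_distrlr/=.
  rewrite -!big_distrlr/=; ring.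
rewrite mulr_sumr -big_split -sumrB/=; apply: eq_bigr => i _.
rewrite mulr_sumr -big_split -sumrB/=; apply: eq_bigr => j _; ring.
Qed.

Lemma enormD x y : enorm (x + y) <= enorm x + enorm y.
Proof.
rewrite -(ler_pXn2r (ltn0Sn 1)) ?nnegrE ?addr_ge0 ?enorm_ge0//.
rewrite sqrrD !sqr_enorm.
have -> : dot (x + y) (x + y) = dot x x + dot x y *+ 2 + dot y y.
  rewrite -[y in x + y]opprK !(dotBl, dotBr).
  have N z w : dot z (- w) = - dot z w.
    by rewrite -[- w]add0r dotBr /dot big1 ?sub0r// => i _; rewrite mxE mulr0.
  rewrite [dot (- y) x]dotC !N [dot (-y) y]dotC !N; ring.
rewrite lerD2r lerD2l lerMn2r/=.
apply: le_trans (ler_norm _) _; rewrite -sqrtr_sqr !enormE -sqrtrM//.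
by rewrite ler_wsqrtr.
Qed.

Lemma enormB_trans y x z : enorm (x - z) <= enorm (x - y) + enorm (y - z).
Proof. by have := enormD (x - y) (y - z); rewrite addrA subrK. Qed.

(* Polarization makes [f - f 0] preserve inner products up to [c ^ 2], so that
   the images of the canonical basis form an invertible matrix. *)
Lemma similarity_surjective (f : 'rV[R]_d -> 'rV[R]_d) (c : R) (y : 'rV[R]_d) :
  0 < c -> is_similarity f c -> exists x, f x = y.
Proof.
move=> c0 fc.
pose g x := f x - f 0.
have gdot x z : dot (g x) (g z) = c ^+ 2 * dot x z.
  have E u v : dot u v = (dot u u + dot v v - dot (u - v) (u - v)) / 2.
    by rewrite dotBl !dotBr [dot v u]dotC; field.
  rewrite E [in RHS]E.
  have -> : g x - g z = f x - f z by rewrite /g opprB addrA subrK.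
  by rewrite -!sqr_enorm !fc !subr0; field.
pose A := \matrix_(i < d) g (delta_mx 0 i).
have dotA x i : (g x *m A^T) 0 i = c ^+ 2 * x 0 i.
  rewrite mxE; transitivity (dot (g x) (g (delta_mx 0 i))).
    by apply: eq_bigr => j _; rewrite !mxE.
  rewrite gdot; congr (_ * _); rewrite /dot (bigD1 i)//= mxE !eqxx mulr1.
  by rewrite big1 ?addr0// => j ji; rewrite mxE (negbTE ji) andbF mulr0.
have AA : A *m A^T = (c ^+ 2)%:M.
  apply/row_matrixP => i; rewrite row_mul rowK; apply/rowP => j.
  by rewrite dotA !mxE eqxx/= eq_sym mulr_natr.
have c2 : c ^+ 2 \is a GRing.unit by rewrite unitfE expf_eq0/= gt_eqF.
have Au : A^T \in unitmx.
  have : (A *m A^T) \in unitmx by rewrite AA unitmxE det_scalar unitrX.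
  by rewrite unitmx_mul => /andP[].
exists ((c ^+ 2)^-1 *: ((y - f 0) *m A^T)).
apply: (addIr (- f 0)); rewrite -/(g _); apply: (can_inj (mulmxK Au)).
apply/rowP => i; rewrite dotA mxE mulrA divrr// mul1r//.
Qed.

(* Pigeonhole on a grid of mesh less than [b * rho / d]. *)
Lemma packing (a b : R) : 0 < b -> exists K : nat,
  forall (T : eqType) (s : seq T) (y : T -> 'rV[R]_d) (p : 'rV[R]_d) (rho : R),
    0 < rho -> uniq s ->
    (forall u, u \in s -> enorm (y u - p) <= a * rho) ->
    (forall u v, u \in s -> v \in s -> u != v -> b * rho <= enorm (y u - y v))
      ->
  (size s <= K)%N.
Proof.
move=> b0.
(* An interval of length [2 * a * rho] needs at most [m.+1] cells of side [h]; [d.+1] rather than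
   [d] keeps the last inequality strict and covers [d = 0]. *)
pose m := Num.truncn (2 * a * d.+1%:R / b).
exists #|{ffun 'I_d -> 'I_m.+1}| => T s y p rho rho0 us ya yb.
pose h := b * rho / d.+1%:R.
have h0 : 0 < h by rewrite divr_gt0 ?mulr_gt0.
pose q u i := (y u 0 i - p 0 i + a * rho) / h.
have qb u i : u \in s -> 0 <= q u i <= 2 * a * d.+1%:R / b.
  move=> /ya yu; have := le_trans (coord_le_enorm _ i) yu.
  rewrite !mxE ler_norml => /andP[l1 l2].
  rewrite /q divr_ge0 ?(ltW h0)//=; last by rewrite -lerBlDr sub0r.
  rewrite ler_pdivrMr// /h.
  have -> : 2 * a * d.+1%:R / b * (b * rho / d.+1%:R) = a * rho + a * rho.
    by field; rewrite !gt_eqF.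
  by rewrite lerD2r.
pose k u : {ffun 'I_d -> 'I_m.+1} := [ffun i => inord (Num.truncn (q u i))].
have kE u i : u \in s -> k u i = Num.truncn (q u i) :> nat.
  move=> /(qb _ i)/andP[_ l]; rewrite ffunE inordK// ltnS.
  exact: le_truncn.
have kinj : {in s &, injective k}.
  move=> u v us' vs' kuv; apply/eqP; apply: contraT => /(yb _ _ us' vs').
  rewrite leNgt => /negP[].
  apply: le_lt_trans (enorm_le_sum _) _.
  have le1 : \sum_(i < d) `|(y u - y v) 0 i| <= \sum_(i < d) h.
    apply: ler_sum => i _.
    have /(congr1 val) : k u i = k v i by rewrite kuv.
    rewrite /= !kE// => tE.
    have /andP[qu0 _] := qb u i us'; have /andP[qv0 _] := qb v i vs'.
    have := truncn_itv qu0; have := truncn_itv qv0.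
    rewrite tE => /andP[v1 v2] /andP[u1 u2].
    have -> : (y u - y v) 0 i = (q u i - q v i) * h.
      by rewrite /q !mxE; field; rewrite gt_eqF.
    rewrite normrM (gtr0_norm h0) ler_piMl ?(ltW h0)// ler_norml.
    move: v1 v2 u1 u2; rewrite -natr1; set t := _%:R => *.
    by apply/andP; split; lra.
  apply: le_lt_trans le1 _.
  rewrite sumr_const card_ord /h -[ltLHS]mulr_natr mulrAC.
  rewrite ltr_pdivrMr//.
  by rewrite ltr_pM2l ?mulr_gt0// ltr_nat.
rewrite -(size_map k) -(card_uniqP _) ?map_inj_in_uniq//.
exact: max_card.
Qed.

End Euclidean.

(** * Topology in terms of the Euclidean norm *)

Section EuclideanTopology.
Context (R : realType) (d : nat).
Implicit Types (x y : 'rV[R]_d) (A : set 'rV[R]_d).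

Lemma nbhs_enorm x A : nbhs x A ->
  exists2 e, 0 < e & forall y, enorm (x - y) < e -> A y.
Proof.
move=> /nbhs_ballP[e /= e0 eA]; exists e => // y xy; apply: eA; split=> // i j.
rewrite /ball/= ord1; apply: le_lt_trans xy.
by have := coord_le_enorm (x - y) j; rewrite !mxE.
Qed.

Lemma enorm_nbhs x e : 0 < e -> nbhs x [set y | enorm (x - y) < e].
Proof.
move=> e0; apply/nbhs_ballP; exists (e / d.+1%:R) => /=; first by rewrite
  divr_gt0.
move=> y [_ xy] /=; apply: le_lt_trans (enorm_le_sum _) _.
apply: (@le_lt_trans _ _ (\sum_(i < d) (e / d.+1%:R))).
  apply: ler_sum => i _; rewrite !mxE ltW//.
  by have := xy 0 i; rewrite /ball/=.
rewrite sumr_const card_ord -[ltLHS]mulr_natr mulrAC ltr_pdivrMr//.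
by rewrite ltr_pM2l// ltr_nat.
Qed.

Lemma enorm_open x e : open [set y | enorm (x - y) < e].
Proof.
rewrite openE => y /= xy.
have e0 : 0 < e - enorm (x - y) by rewrite subr_gt0.
apply: filterS (enorm_nbhs y e0) => z /= yz.
by apply: le_lt_trans (enormB_trans y _ _) _; rewrite -ltrBrDl.
Qed.

Lemma compact_enorm_le A : compact A ->
  exists2 D, 0 < D & forall x, A x -> enorm x <= D.
Proof.
move=> /compact_bounded/ex_strict_bound_gt0[D /= D0 AD].
exists (d.+1%:R * D); first by rewrite mulr_gt0.
move=> x /AD xD; apply: le_trans (enorm_le_sum _) _.
apply: (@le_trans _ _ (\sum_(i < d) D)).
  apply: ler_sum => i _; apply: le_trans (ltW xD).
  rewrite /Num.norm/= mx_normrE.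
  by rewrite (le_trans _ (le_bigmax _ _ (0, i))).
by rewrite sumr_const card_ord -[leLHS]mulr_natl ler_wpM2r ?ler_nat// ltW.
Qed.

Lemma similarity_continuous (g : 'rV[R]_d -> 'rV[R]_d) (a : R) :
  0 < a -> is_similarity g a -> continuous g.
Proof.
move=> a0 ga x A /nbhs_enorm[e e0 eA].
have ea0 : 0 < e / a by rewrite divr_gt0.
apply: filterS (enorm_nbhs x ea0) => y /= xy; apply: eA.
by rewrite ga mulrC -ltr_pdivlMr.
Qed.

End EuclideanTopology.

(** * Coverings and dimensions *)

Section Covers.
Context (R : realType) (d : nat).
Implicit Types (A X Y F : set 'rV[R]_d) (r s : R) (n : nat).

Lemma le_diam A x y : A x -> A y -> ((enorm (x - y))%:E <= diam A)%E.
Proof.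
move=> Ax Ay; rewrite /diam le_max; apply/orP; right.
by apply: ereal_sup_ubound; exists (x, y).
Qed.

Lemma diam_le A r : 0 <= r -> (forall x y, A x -> A y -> enorm (x - y) <= r) ->
  (diam A <= r%:E)%E.
Proof.
move=> r0 Ar; rewrite /diam ge_max lee_fin r0/=.
by apply: ge_ereal_sup => _ [[x y] [Ax Ay] <-]; rewrite lee_fin; exact: Ar.
Qed.

Lemma diam_ge0 A : (0 <= diam A)%E.
Proof. by rewrite /diam le_max lexx. Qed.

(** The condition inside the infimum of [cover_number], kept apart so that covers are counted in
    [nat]. *)
Definition covered r n X := exists U : 'I_n -> set 'rV[R]_d,
  (forall i, (diam (U i) <= r%:E)%E) /\ X `<=` \bigcup_i U i.

Lemma covered_sub r n X Y : X `<=` Y -> covered r n Y -> covered r n X.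
Proof. by move=> XY [U [Ur UY]]; exists U; split => // x /XY /UY. Qed.

Lemma coveredD r n m X Y : covered r n X -> covered r m Y ->
  covered r (n + m) (X `|` Y).
Proof.
move=> [U [Ur UX]] [V [Vr VY]].
exists (fun i => match fintype.split i with inl j => U j | inr j => V j end);
  split.
  by move=> i; case: fintype.split.
move=> x [/UX[i _ Ui]|/VY[i _ Vi]].
  by exists (unsplit (inl i)) => //; rewrite unsplitK.
by exists (unsplit (inr i)) => //; rewrite unsplitK.
Qed.

Lemma covered0 r n : 0 <= r -> covered r n set0.
Proof.
move=> r0; exists (fun=> set0); split => // i.
by apply: diam_le => // x y [].
Qed.

Lemma covered_leq r n m X : 0 <= r -> (n <= m)%N -> covered r n X -> covered r
  m X.
Proof.
move=> r0 nm nX; rewrite -(subnKC nm) -[X]setU0.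
by apply: coveredD => //; exact: covered0.
Qed.

Lemma covered_bigcup (T : eqType) (l : seq T) (A : T -> set 'rV[R]_d) r n X :
  0 <= r -> (forall u, u \in l -> covered r n (A u)) ->
  (forall x, X x -> exists2 u, u \in l & A u x) -> covered r (size l * n) X.
Proof.
move=> r0; elim: l X => [|u l IH] X lA XA.
  by apply: covered_sub (covered0 _ r0) => x /XA[].
apply: (@covered_sub _ _ _ (A u `|` (X `&` ~` A u))).
  by move=> x Xx; case: (pselect (A u x)) => ?; [left|right].
rewrite /= mulSn; apply: coveredD; first by apply: lA; rewrite mem_head.
apply: IH => [v vl|x [/XA[v + Av nAu]]].
  by apply: lA; rewrite inE vl orbT.
by rewrite inE => /orP[/eqP vu|vl]; [rewrite vu in Av|exists v].
Qed.

Lemma cover_number_le r n X : covered r n X -> (cover_number r X <= n%:R%:E)%E.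
Proof. by move=> [U UX]; apply: ereal_inf_lbound; exists n => //; exists U. Qed.

Lemma cover_number_covered r X (b : R) : 0 <= r -> 0 <= b ->
  (cover_number r X <= b%:E)%E -> covered r (Num.truncn (b + 1)) X.
Proof.
move=> r0 b0 Xb.
have /ereal_inf_lt[_ [n [U nU] <-]] : (cover_number r X < (b + 1)%:E)%E.
  by apply: le_lt_trans Xb _; rewrite lte_fin ltrDl.
rewrite lte_fin => nb; apply: (@covered_leq _ n) => //; last by exists U.
by rewrite truncn_ge_nat ?addr_ge0// ltW.
Qed.

Lemma hausdorff_gauge_ge0 s A : (0 <= hausdorff_gauge s A)%E.
Proof. by rewrite /hausdorff_gauge; case: ifP => // _; exact: poweR_ge0. Qed.

Lemma hausdorff_gauge_le s A r : 0 <= s -> (diam A <= r%:E)%E ->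
  (hausdorff_gauge s A <= (r `^ s)%:E)%E.
Proof.
move=> s0 Ar; rewrite /hausdorff_gauge; case: ifP => _.
  by rewrite lee_fin powR_ge0.
rewrite -poweR_EFin; apply: gt0_ler_poweR => //.
  by rewrite in_itv/= diam_ge0 leey.
by rewrite in_itv/= leey andbT (le_trans (diam_ge0 A)).
Qed.

(** The finite cover is padded with empty sets, whose gauge is 0 even for [s = 0]. *)
Lemma hausdorff_premeasure_le s e r n F : 0 <= s -> 0 <= r <= e ->
  covered r n F -> (hausdorff_premeasure s e F <= (n%:R * r `^ s)%:E)%E.
Proof.
move=> s0 /andP[r0 re] [U [Ur FU]].
pose V j : set 'rV[R]_d := if insub j is Some i then U i else set0.
have Vr j : (diam (V j) <= r%:E)%E.
  by rewrite /V; case: insub => [i|]//; apply: diam_le.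
have V0 j : (n <= j)%N -> hausdorff_gauge s (V j) = 0%E.
  by move=> nj; rewrite /V insubF 1?ltnNge ?nj// /hausdorff_gauge asboolT.
apply: (@le_trans _ _ (\sum_(0 <= i <oo) hausdorff_gauge s (V i))%E).
  apply: ereal_inf_lbound; exists V => //; split.
    move=> x /FU[i _ Uix]; exists (val i) => //.
    by rewrite /V insubT//= => in'; rewrite (_ : Sub _ _ = i)//; exact: val_inj.
  by move=> j; apply: le_trans (Vr j) _; rewrite lee_fin.
rewrite (nneseries_split 0 n); last by move=> *; exact: hausdorff_gauge_ge0.
rewrite add0n eseries0 ?adde0; last by move=> j nj _; exact: V0.
apply: (@le_trans _ _ (\sum_(0 <= j < n) (r `^ s)%:E)%E).
  by apply: lee_sum => j _; exact: hausdorff_gauge_le.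
by rewrite sumEFin lee_fin sumr_const_nat subn0 mulr_natl.
Qed.

Lemma dim_H_le F s : 0 <= s -> (forall e eta : R, 0 < e -> 0 < eta ->
    exists n r, [/\ 0 <= r <= e, covered r n F & n%:R * r `^ s <= eta]) ->
  (dim_H F <= s%:E)%E.
Proof.
move=> s0 Fs; apply: ereal_inf_lbound; exists s => //; split => //.
apply/eqP; rewrite eq_le; apply/andP; split; last first.
  apply: le_ereal_sup_tmp; exists (hausdorff_premeasure s 1 F).
    by exists 1 => /=.
  apply: le_ereal_inf_tmp => _ [U _ <-].
  by apply: nneseries_ge0 => *; exact: hausdorff_gauge_ge0.
apply: ge_ereal_sup => _ [e /= e0 <-]; apply/lee_addgt0Pr => eta eta0.
have [n [r [re nF nr]]] := Fs e eta e0 eta0.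
by rewrite add0e; apply: le_trans (hausdorff_premeasure_le s0 re nF) _.
Qed.

(* A ball of fixed radius [rho] is covered by [C * (rho / r) ^ a] sets of
   diameter [r], and finitely many such balls cover [F]. *)
Lemma dim_H_le_qA_spectrum F delta : compact F -> 0 < delta ->
  (dim_H F <= qA_spectrum delta F)%E.
Proof.
move=> Fc delta0; apply: le_ereal_inf_tmp => _ [a [a0 [C C0 Ca]] <-].
apply/lee_addgt0Pr => b b0; rewrite -EFinD; apply: dim_H_le.
  by rewrite addr_ge0// ltW.
have ab0 : a + b != 0 by rewrite gt_eqF// ltr_wpDl.
(* If [F] has at most one point, one set of diameter 0 is enough, since the exponent [a + b] is
   positive. *)
move=> e eta e0 eta0; have [D0|D0] := leP (diam F) 0%E.
  exists 1%N, 0; split; first by rewrite lexx ltW.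
    by exists (fun=> F); split => // x Fx; exists ord0.
  by rewrite powR0// mulr0 ltW.
have [D D1 DF] : exists2 D : R, 0 < D & (D%:E <= diam F)%E.
  by case: (diam F) D0 => // [r|] r0; [exists r|exists 1; rewrite ?leey].
have d1 : 1 + delta != 0 by rewrite gt_eqF// ltr_wpDl.
pose rho := D `^ (1 + delta)^-1; have rho0 : 0 < rho by rewrite powR_gt0.
have rhoE : rho `^ (1 + delta) = D by rewrite /rho -powRrM mulVf// powRr1// ltW.
have [l lF] : exists l : seq 'rV[R]_d, (forall x, x \in l -> F x) /\
    forall x, F x -> exists2 u, u \in l & enorm (u - x) < rho.
  have := Fc; rewrite compact_cover => /(_ _ F (fun x => [set y | enorm (x - y)
    < rho])).
  case=> [x _|x Fx|l lF Fl]; first exact: enorm_open.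
    by exists x => //=; rewrite subrr enorm0.
  exists l; split => [x xl|x /Fl[u /= ul ux]]; last by exists u.
  by have /set_mem := lF _ xl.
pose K := (size l)%:R * (C * rho `^ a + 1).
have K0 : 0 <= K by rewrite mulr_ge0// addr_ge0// mulr_ge0 ?powR_ge0// ltW.
(* The count times the power [a + b] of [r] will be at most [K] times the power [b] of [r];
   [r <= kappa] brings this below [eta]. *)
pose kappa := (eta / (K + 1)) `^ b^-1.
have K10 : 0 < K + 1 by rewrite ltr_wpDl.
have kappa0 : 0 < kappa by rewrite powR_gt0// divr_gt0.
pose r := Num.min (Num.min e 1) (Num.min D kappa).
have r0 : 0 < r by rewrite !lt_min e0 ltr01 D1 kappa0.
have re : r <= e by rewrite /r !ge_min lexx.
have r1 : r <= 1 by rewrite /r !ge_min lexx orbT.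
have rD : r <= D by rewrite /r !ge_min lexx !orbT.
have rk : r <= kappa by rewrite /r !ge_min lexx !orbT.
have bd0 : 0 <= C * (rho / r) `^ a by rewrite mulr_ge0 ?powR_ge0// ltW.
pose m := Num.truncn (C * (rho / r) `^ a + 1).
exists (size l * m)%N, r; split; first by rewrite ltW.
- case: lF => lF Fl.
  apply: (@covered_bigcup _ _ (fun u => eball u rho `&` F)).
  + exact: ltW.
  + move=> u /lF Fu; apply: cover_number_covered => //; first exact: ltW.
    have := Ca r rho r0 rho0; rewrite rhoE => /(_ rD DF); apply: le_trans.
    by apply: ereal_sup_ubound; exists u.
  + by move=> x Fx; have [u ul ux] := Fl x Fx; exists u.
- have rb : r `^ (a + b) <= r `^ b by rewrite ger_powR ?r0// lerDr.
  have mb : m%:R * r `^ (a + b) <= (C * rho `^ a + 1) * r `^ b.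
    apply: (@le_trans _ _ ((C * (rho / r) `^ a + 1) * r `^ (a + b))).
      by rewrite ler_wpM2r ?powR_ge0// truncn_le addr_ge0.
    rewrite !mulrDl !mul1r lerD// powRM ?invr_ge0 ?(ltW rho0) ?(ltW r0)//.
    rewrite -(powR_inv1 (ltW r0)) -powRrM mulN1r !mulrA -mulrA -powRD.
      by rewrite addrA addNr add0r.
    by rewrite (gt_eqF r0) implybT.
  rewrite natrM -mulrA; apply: (@le_trans _ _ (K * r `^ b)).
    by rewrite /K -[leRHS]mulrA ler_wpM2l.
  apply: (@le_trans _ _ (K * kappa `^ b)).
    by rewrite ler_wpM2l// ge0_ler_powR ?nnegrE ?(ltW r0) ?(ltW kappa0) ?(ltW
      b0).
  rewrite /kappa -powRrM mulVf ?gt_eqF// powRr1 ?divr_ge0 ?(ltW eta0) ?(ltW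
    K10)//.
  by rewrite mulrCA ger_pMr// ler_pdivrMr// mul1r lerDl.
Qed.

End Covers.

(** * Words and cutsets *)

Section Cutsets.
Context (R : realType) (M : nat).
Variables (N : nat -> nat) (c : nat -> 'I_M -> R).
Implicit Types (v w u : seq 'I_M) (n t : nat) (rho s : R).

Fixpoint word_ok n v : bool :=
  if v is i :: w then (i < N n)%N && word_ok n.+1 w else true.

Fixpoint rate n v : R := if v is i :: w then c n i * rate n.+1 w else 1.

(** The words along which the product of the rates first drops to [rho] or below: [rho] is divided
    by the rate of each letter until it reaches 1. At most [t] letters are read; for [rho = 0] the
    rule never applies, so that [cutset t n 0] lists all admissible words of length [t]. *)
Fixpoint cutset t n rho : seq (seq 'I_M) :=
  if t is t'.+1 then
    if 1 <= rho then [:: [::]] else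
      flatten [seq [seq i :: w | w <- cutset t' n.+1 (rho / c n i)] |
        i : 'I_M <- enum 'I_M & (i < N n)%N]
  else [:: [::]].

Definition rate_sum s n : R := \sum_(i < M | (i < N n)%N) c n i `^ s.

(** The probability of [v] when the letters are drawn independently, letter [i] at position [n] with
    weight proportional to the power [s] of [c n i]. *)
Fixpoint mass s n v : R :=
  if v is i :: w then c n i `^ s / rate_sum s n * mass s n.+1 w else 1.

Lemma mem_cutset t n rho v : rho < 1 ->
  v \in cutset t.+1 n rho ->
  exists (i : 'I_M) w, [/\ v = i :: w, (i < N n)%N & w \in cutset t n.+1 (rho /
    c n i)].
Proof.
move=> rho1 /=; rewrite leNgt rho1/= => /flattenP[s /mapP[i]].
rewrite mem_filter mem_enum/= => /andP[iN _] -> /mapP[w wc ->].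
by exists i, w.
Qed.

Lemma cutset_stop t n rho : 1 <= rho -> cutset t n rho = [:: [::]].
Proof. by case: t => //= t ->. Qed.

Lemma cutset_cons t n rho (i : 'I_M) w : rho < 1 -> (i < N n)%N ->
  w \in cutset t n.+1 (rho / c n i) -> i :: w \in cutset t.+1 n rho.
Proof.
move=> rho1 iN wc /=; rewrite leNgt rho1/=; apply/flattenP.
exists (map (cons i) (cutset t n.+1 (rho / c n i))).
  by apply/mapP; exists i => //; rewrite mem_filter iN mem_enum.
by apply/mapP; exists w.
Qed.

Lemma big_cutset t n rho (Q : pred (seq 'I_M)) (F : seq 'I_M -> R) :
  rho < 1 ->
  \sum_(v <- cutset t.+1 n rho | Q v) F v = \sum_(i < M | (i < N n)%N)
    \sum_(w <- cutset t n.+1 (rho / c n i) | Q (i :: w)) F (i :: w).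
Proof.
move=> rho1 /=; rewrite leNgt rho1/= big_flatten/= big_map big_filter.
by rewrite big_enum_cond/=; apply: eq_bigr => i _; rewrite big_map.
Qed.

Lemma cutset_word_ok t n rho v : v \in cutset t n rho -> word_ok n v.
Proof.
elim: t n rho v => [|t IH] n rho v; first by rewrite inE => /eqP ->.
have [rho1|rho1] := leP 1 rho.
  by rewrite cutset_stop// inE => /eqP ->.
by move=> /(mem_cutset rho1)[i [w [-> /= -> /IH]]].
Qed.

Lemma cutset_uniq t n rho : uniq (cutset t n rho).
Proof.
elim: t n rho => [//|t IH] n rho /=; case: ifP => // _.
apply: allpairs_uniq_dep => [|i _|].
- by rewrite filter_uniq// enum_uniq.
- exact: IH.
- move=> [i w] [j w']/= _ _ [ij]; case: _ / ij w' => w' -> //.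
Qed.

Lemma cutset_size t n rho v : v \in cutset t n rho -> (size v <= t)%N.
Proof.
elim: t n rho v => [|t IH] n rho v; first by rewrite inE => /eqP ->.
have [rho1|rho1] := leP 1 rho; first by rewrite cutset_stop// inE => /eqP ->.
by move=> /(mem_cutset rho1)[i [w [-> _ /IH]]].
Qed.

Lemma cutset_prefix t n rho w : word_ok n w -> (t <= size w)%N ->
  exists v u, v \in cutset t n rho /\ w = v ++ u.
Proof.
elim: t n rho w => [|t IH] n rho w.
  by move=> _ _; exists [::], w; rewrite inE eqxx.
have [rho1|rho1] := leP 1 rho.
  by move=> _ _; exists [::], w; rewrite cutset_stop// inE eqxx.
case: w => [//|i w]/= /andP[iN wok]; rewrite ltnS => tw.
have [v [u [vc ->]]] := IH _ (rho / c n i) _ wok tw.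
by exists (i :: v), u; split => //; exact: cutset_cons.
Qed.

Lemma word_ok_cat n v u :
  word_ok n (v ++ u) = word_ok n v && word_ok (n + size v) u.
Proof.
elim: v n => [|i v IH] n /=; first by rewrite addn0.
by rewrite IH andbA addSnnS.
Qed.

Lemma rate_cat n v u : rate n (v ++ u) = rate n v * rate (n + size v) u.
Proof.
elim: v n => [|i v IH] n /=; first by rewrite addn0 mul1r.
by rewrite IH mulrA addSnnS.
Qed.

Variables (cmin cmax : R).
Hypotheses (cmin0 : 0 < cmin) (cmax1 : cmax < 1).
Hypothesis cb : forall n i, cmin <= c n i <= cmax.

Let c0 n i : 0 < c n i.
Proof. by have /andP[+ _] := cb n i; exact: lt_le_trans. Qed.

Lemma rate_gt0 n v : 0 < rate n v.
Proof. by elim: v n => //= i v IH n; rewrite mulr_gt0. Qed.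

Lemma rate_le n v : rate n v <= cmax ^+ size v.
Proof.
elim: v n => [|i v IH] n //=; rewrite exprS ler_pM ?IH ?(ltW (c0 n i)) ?(ltW
  (rate_gt0 _ _))//.
by have /andP[] := cb n i.
Qed.

(** The hypothesis on [t] ensures that the recursion ends by the stopping rule and not for lack of
    letters; it is inherited because each rate is at most [cmax]. *)
Lemma cutset_rate_le t n rho v : cmax ^+ t <= rho -> v \in cutset t n rho ->
  rate n v <= rho.
Proof.
elim: t n rho v => [|t IH] n rho v trho; first by rewrite inE => /eqP ->.
have [rho1|rho1] := leP 1 rho; first by rewrite cutset_stop// inE => /eqP ->.
move=> /(mem_cutset rho1)[i [w [-> _ wc]]] /=.
have /andP[_ ci] := cb n i.
have trho' : cmax ^+ t <= rho / c n i.
  rewrite ler_pdivlMr//; apply: le_trans trho; rewrite exprSr.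
  by rewrite ler_wpM2l// exprn_ge0// (le_trans (ltW (c0 n i))).
by have := IH _ _ _ trho' wc; rewrite ler_pdivlMr// [c n i * _]mulrC.
Qed.

(** Before its last letter a nonempty word has rate above [rho], and one letter loses at most the
    factor [cmin]. The condition [cmin * rho <= 1] takes care of the empty word. *)
Lemma cutset_rate_ge t n rho v : cmin * rho <= 1 -> v \in cutset t n rho ->
  cmin * rho <= rate n v.
Proof.
elim: t n rho v => [|t IH] n rho v crho; first by rewrite inE => /eqP ->.
have [rho1|rho1] := leP 1 rho; first by rewrite cutset_stop// inE => /eqP ->.
move=> /(mem_cutset rho1)[i [w [-> _ wc]]] /=.
have /andP[ci _] := cb n i.
have crho' : cmin * (rho / c n i) <= 1.
  rewrite mulrA ler_pdivrMr// mul1r (le_trans _ ci)//.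
  by rewrite ler_piMr ?ltW.
by have := IH _ _ _ crho' wc; rewrite mulrA ler_pdivrMr// [c n i * _]mulrC.
Qed.

Hypothesis N0 : forall n, (0 < N n <= M)%N.

Lemma rate_sum_ge s n : 0 <= s -> cmin `^ s <= rate_sum s n.
Proof.
move=> s0; have /andP[N1 N2] := N0 n.
rewrite /rate_sum (bigD1 (Ordinal (leq_trans N1 N2)))//=.
rewrite -[leLHS]addr0 lerD//; last by rewrite sumr_ge0// => i _; exact:
  powR_ge0.
apply: ge0_ler_powR; rewrite ?nnegrE ?(ltW cmin0) ?(ltW (c0 _ _))//.
by have /andP[] := cb n (Ordinal (leq_trans N1 N2)).
Qed.

Lemma rate_sum_gt0 s n : 0 <= s -> 0 < rate_sum s n.
Proof. by move=> /(rate_sum_ge n); apply: lt_le_trans; exact: powR_gt0. Qed.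

Lemma rate_sum_le s n : 0 <= s -> rate_sum s n <= M%:R.
Proof.
move=> s0; rewrite /rate_sum -[M in leRHS]card_ord -sumr_const big_mkcond/=.
apply: ler_sum => i _; case: ifP => // _.
rewrite -(powRr0 (c n i)); apply: ger_powR; rewrite ?c0//.
by have /andP[_ +] := cb n i; move/le_trans; apply; exact: ltW.
Qed.

Lemma mass_ge0 s n v : 0 <= s -> 0 <= mass s n v.
Proof.
move=> s0; elim: v n => //= i v IH n; rewrite mulr_ge0// divr_ge0 ?powR_ge0//.
exact/ltW/rate_sum_gt0.
Qed.

Lemma massE s n v : 0 <= s ->
  mass s n v = rate n v `^ s / \prod_(n <= j < n + size v) rate_sum s j.
Proof.
move=> s0; elim: v n => [|i v IH] n /=.
  by rewrite addn0 big_geq// divr1 powR1.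
rewrite IH powRM ?ltW ?rate_gt0// addnS addSn.
rewrite [in RHS]big_nat_recl ?leq_addr//= invfM.
have -> : \prod_(n <= j < n + size v) rate_sum s j.+1 =
  \prod_(n.+1 <= j < (n + size v).+1) rate_sum s j by rewrite big_add1.
by ring.
Qed.

(** The weights of the letters at each position add up to 1, and a cutset contains exactly one
    prefix of each infinite admissible word. *)
Lemma sum_mass s t n rho : 0 <= s ->
  \sum_(v <- cutset t n rho) mass s n v = 1.
Proof.
move=> s0; elim: t n rho => [|t IH] n rho; first by rewrite big_seq1.
have [rho1|rho1] := leP 1 rho; first by rewrite cutset_stop// big_seq1.
rewrite big_cutset//= -[RHS](divff (lt0r_neq0 (rate_sum_gt0 n s0))).
rewrite [X in _ = X / _]/rate_sum [in RHS]mulr_suml.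
by apply: eq_bigr => i iN; rewrite -mulr_sumr IH mulr1.
Qed.

(** The left sum runs over words of length [T], each of which extends a word of the other cutset as
    [t <= T]; the mass of [v] is the total mass of its extensions. *)
Lemma mass_cutset_le s t T n rho (A Q : pred (seq 'I_M)) : 0 <= s ->
  (t <= T)%N ->
  (forall v u, v \in cutset t n rho -> A (v ++ u) -> Q v) ->
  \sum_(w <- cutset T n 0 | A w) mass s n w <=
  \sum_(v <- cutset t n rho | Q v) mass s n v.
Proof.
(* The cutset reduced to the empty word: either [Q] holds there and the bound is the total mass 1,
   or no word satisfies [A]. *)
move=> s0; have stop T' n' (A' Q' : pred (seq 'I_M)) :
    (forall u, A' u -> Q' [::]) ->
    \sum_(w <- cutset T' n' 0 | A' w) mass s n' w <=
    \sum_(v <- [:: [::]] | Q' v) mass s n' v.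
  move=> AQ; rewrite big_cons big_nil; case: ifPn => [_|Q0].
    rewrite /= addr0 -[leRHS](sum_mass T' n' 0 s0) [leRHS](bigID A')/= lerDl.
    by apply: sumr_ge0 => w _; exact: mass_ge0.
  rewrite big1// => w /AQ Q1; by rewrite Q1 in Q0.
elim: t T n rho A Q => [|t IH] T n rho A Q tT AQ.
  by apply: stop => u; apply: (AQ [::]); rewrite inE.
have [rho1|rho1] := leP 1 rho.
  rewrite (cutset_stop _ _ rho1); apply: stop => u; apply: (AQ [::]).
  by rewrite cutset_stop// inE.
case: T tT => // T; rewrite ltnS => tT.
rewrite !big_cutset//; apply: ler_sum => i iN /=.
rewrite -!mulr_sumr ler_wpM2l//.
  by rewrite divr_ge0 ?powR_ge0// ltW// rate_sum_gt0.
rewrite mul0r; apply: (IH _ _ _ (fun w => A (i :: w)) (fun w => Q (i :: w))) =>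
  //.
move=> v u vc; apply: (AQ (i :: v)).
exact: cutset_cons.
Qed.

End Cutsets.

(** * Moran sets *)

Section Moran.
Context (R : realType) (d M : nat).
Variables (N : nat -> nat) (c : nat -> 'I_M -> R).
Variable (f : nat -> 'I_M -> 'rV[R]_d -> 'rV[R]_d).
Implicit Types (v w u : seq 'I_M) (n t : nat) (rho s : R).

Fixpoint word_map n v : 'rV[R]_d -> 'rV[R]_d :=
  if v is i :: w then f n i \o word_map n.+1 w else id.

(** The attractor of a sequence of systems, one per level, which is what [attractor] becomes on a
    homogeneous labelling. *)
Definition moran_set (Delta : set 'rV[R]_d) : set 'rV[R]_d :=
  \bigcap_(n in [set n | (0 < n)%N])
    \bigcup_(v in [set v | size v = n /\ word_ok N 0 v])
      (word_map 0 v @` Delta).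

Lemma word_map_cat n v u x :
  word_map n (v ++ u) x = word_map n v (word_map (n + size v) u x).
Proof.
elim: v n => [|i v IH] n /=; first by rewrite addn0.
by rewrite IH addSnnS.
Qed.

Variables (cmin cmax : R).
Hypotheses (cmin0 : 0 < cmin) (cmax1 : cmax < 1).
Hypothesis cb : forall n i, cmin <= c n i <= cmax.
Hypothesis N0 : forall n, (0 < N n <= M)%N.
Hypothesis fsim : forall n (i : 'I_M), (i < N n)%N -> is_similarity (f n i) (c
  n i).

Let c0 n i : 0 < c n i.
Proof. by have /andP[+ _] := cb n i; exact: lt_le_trans. Qed.

Let cmin_le_cmax : cmin <= cmax.
Proof.
have /andP[N1 N2] := N0 0%N.
have /andP[] := cb 0%N (Ordinal (leq_trans N1 N2)); exact: le_trans.
Qed.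

Lemma word_map_similarity n v :
  word_ok N n v -> is_similarity (word_map n v) (rate c n v).
Proof.
elim: v n => [|i v IH] n /=; first by move=> _ x y; rewrite mul1r.
by move=> /andP[iN vok] x y; rewrite fsim// IH// mulrA.
Qed.

Section Disjoint.
Variable O : set 'rV[R]_d.
Hypothesis fO : forall n (i : 'I_M), (i < N n)%N -> f n i @` O `<=` O.
Hypothesis fOI : forall n (i j : 'I_M), (i < N n)%N -> (j < N n)%N ->
  (f n i @` O) `&` (f n j @` O) !=set0 -> i = j.

Lemma word_map_sub n v x : word_ok N n v -> O x -> O (word_map n v x).
Proof.
elim: v n => //= i v IH n /andP[iN vok] Ox.
by apply: (fO iN); exists (word_map n.+1 v x) => //; exact: IH.
Qed.

(** A common point forces equal first letters by the open set condition; similarities of positive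
    rate are injective, so the first map can be cancelled. *)
Lemma cutset_disjoint t n rho v w x y :
  v \in cutset N c t n rho -> w \in cutset N c t n rho -> O x -> O y ->
  word_map n v x = word_map n w y -> v = w.
Proof.
move=> + + Ox Oy; elim: t n rho v w => [|t IH] n rho v w.
  by rewrite !inE => /eqP-> /eqP->.
have [rho1|rho1] := leP 1 rho.
  by rewrite cutset_stop// !inE => /eqP-> /eqP->.
move=> /(mem_cutset rho1)[i [v' [-> iN vc]]].
move=> /(mem_cutset rho1)[j [w' [-> jN wc]]] /= vw.
have vO := word_map_sub (cutset_word_ok vc) Ox.
have wO := word_map_sub (cutset_word_ok wc) Oy.
have ij : i = j.
  apply: (fOI iN jN); exists (f n i (word_map n.+1 v' x)); split.
    by exists (word_map n.+1 v' x).
  by exists (word_map n.+1 w' y).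
rewrite -ij in wc vw *; congr (_ :: _); apply: (IH _ _ _ _ vc wc).
apply/eqP; rewrite -subr_eq0 -enorm_eq0.
apply/negPn/negP => /negbTE e0.
have := fsim iN (word_map n.+1 v' x) (word_map n.+1 w' y).
rewrite vw ij subrr enorm0 => /esym/eqP.
by rewrite -ij mulf_eq0 e0 gt_eqF.
Qed.

End Disjoint.

Variable Delta : set 'rV[R]_d.
Hypotheses (Delta0 : Delta !=set0) (Delta_compact : compact Delta).
Hypothesis fDelta : forall n (i : 'I_M), (i < N n)%N -> f n i @` Delta `<=`
  Delta.

Let F := moran_set Delta.

Lemma word_map_compact n v : word_ok N n v -> compact (word_map n v @` Delta).
Proof.
move=> vok; apply: continuous_compact => //; apply: continuous_subspaceT.
apply: (similarity_continuous _ (word_map_similarity vok)).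
exact: (rate_gt0 cmin0 cb).
Qed.

Lemma word_map_image_sub n v u : word_ok N n (v ++ u) ->
  word_map n (v ++ u) @` Delta `<=` word_map n v @` Delta.
Proof.
rewrite word_ok_cat => /andP[vok uok] _ [x Dx <-].
rewrite word_map_cat; exists (word_map (n + size v) u x) => //.
exact: (word_map_sub fDelta).
Qed.

Lemma moran_set_sub : F `<=` Delta.
Proof.
move=> x /(_ 1%N isT)[v [_ vok] [y Dy <-]].
exact: (word_map_sub fDelta).
Qed.

Lemma moran_set_compact : compact F.
Proof.
apply: subclosed_compact Delta_compact moran_set_sub.
apply: closed_bigI => n n0; apply: closed_bigcup.
  pose l := map (@tval n 'I_M) (enum {: n.-tuple 'I_M}).
  apply: (@sub_finite_set _ _ [set v | v \in l]); last exact: finite_seq.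
  move=> v [/= /eqP vn _]; apply/mapP; exists (Tuple vn) => //.
  by rewrite mem_enum.
move=> v [_ vok]; apply: compact_closed; last exact: word_map_compact.
exact: norm_hausdorff.
Qed.

(** The word is prolonged for ever by the letter 0, which is allowed as no system is empty. The
    images of [Delta] along the prolongations are nested compact sets, and a cluster point of the
    images of [z0] lies in all of them. *)
Lemma moran_set_cylinder w : word_ok N 0 w ->
  exists2 x, F x & (word_map 0 w @` Delta) x.
Proof.
move=> wok; have [z0 Dz0] := Delta0.
have /andP[N00 NM] := N0 0; pose i0 : 'I_M := Ordinal (leq_trans N00 NM).
have ok0 n m : word_ok N n (nseq m i0).
  elim: m n => //= m IH n; rewrite IH andbT.
  by have /andP[] := N0 n.
pose g n := w ++ nseq n i0.
have gok n : word_ok N 0 (g n) by rewrite word_ok_cat wok ok0.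
pose x n := word_map 0 (g n) z0.
have xg m n : (m <= n)%N -> (word_map 0 (g m) @` Delta) (x n).
  move=> mn; have gE : g n = g m ++ nseq (n - m) i0.
    by rewrite /g -catA cat_nseq /ncons -iterD subnKC.
  apply: (@word_map_image_sub 0 (g m) (nseq (n - m) i0)); first by rewrite -gE.
  by rewrite -gE; exists z0.
have xD : (x @ \oo) Delta by exists 0%N => // n _; exact: (word_map_sub fDelta).
have [p [Dp clp]] := Delta_compact _ xD.
have pg m : (word_map 0 (g m) @` Delta) p.
  have := compact_closed (@norm_hausdorff _ _) (word_map_compact (gok m)).
  apply => A /clp; apply; exists m => // n /= mn; exact: xg.
exists p; last by have := pg 0%N; rewrite /g cats0.
move=> n n0; exists (take n (g n)).
  split; first by rewrite size_takel// size_cat size_nseq leq_addl.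
  by have := gok n; rewrite -{1}(cat_take_drop n (g n)) word_ok_cat => /andP[].
have := pg n; rewrite -{1}(cat_take_drop n (g n)).
by apply: word_map_image_sub; rewrite cat_take_drop.
Qed.

(** A single long word representing [x] is cut twice, the second time along a cutset that starts at
    the level where [v] ends and whose threshold may depend on [v]. *)
Lemma moran_set_prefix t t' rho (rho' : seq 'I_M -> R) x : F x ->
  exists v u, [/\ v \in cutset N c t 0 rho,
    u \in cutset N c t' (size v) (rho' v),
    (word_map 0 v @` Delta) x & (word_map 0 (v ++ u) @` Delta) x].
Proof.
move=> /(_ (t + t').+1 isT)[w [ws wok] wx].
have [|v [u [vc wE]]] := cutset_prefix c rho wok (t := t).
  by rewrite ws leqW ?leq_addr.
have := wok; rewrite wE word_ok_cat add0n => /andP[vok uok].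
have [|u1 [u2 [uc uE]]] := cutset_prefix c (rho' v) uok (t := t').
  have := cutset_size vc; have := congr1 size wE; rewrite ws size_cat; lia.
exists v, u1; split => //; first by apply: (@word_map_image_sub 0 v u); rewrite
  -wE.
by apply: (@word_map_image_sub 0 _ u2); rewrite -catA -uE -wE.
Qed.

Variable O : set 'rV[R]_d.
Hypotheses (O0 : O !=set0) (O_open : open O).
Hypothesis fO : forall n (i : 'I_M), (i < N n)%N -> f n i @` O `<=` O.
Hypothesis fOI : forall n (i j : 'I_M), (i < N n)%N -> (j < N n)%N ->
  (f n i @` O) `&` (f n j @` O) !=set0 -> i = j.

(* The images of a fixed point of [O] under the maps of a cutset are
   separated on the scale [rho]. *)
Lemma cutset_overlap (a : R) : exists K : nat,
  forall t rho (U : set 'rV[R]_d) p, 0 < rho -> cmin * rho <= 1 ->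
    cmax ^+ t <= rho ->
    (forall x, U x -> enorm (x - p) <= a * rho) ->
  (size [seq v <- cutset N c t 0 rho |
     `[< exists2 x, U x & (word_map 0 v @` Delta) x >] ] <= K)%N.
Proof.
have [y0 Oy0] := O0.
have [e e0 eO] : exists2 e, 0 < e & forall y, enorm (y0 - y) < e -> O y.
  by apply: nbhs_enorm; apply: open_nbhs_nbhs.
have [D D0 DD] := compact_enorm_le Delta_compact.
have ce0 : 0 < cmin * e by rewrite mulr_gt0.
(* The first constant bounds the distance from [p] to the images of [y0], in units of [rho];
   [cmin * e] is their separation, since the image of the ball of radius [e] has radius at least
   [cmin * rho * e]. *)
have [K HK] := packing d (enorm y0 + D + a) ce0.
exists K => t rho U p rho0 crho trho Ua.
apply: (HK _ _ (fun v => word_map 0 v y0) p rho) => //.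
- by rewrite filter_uniq// cutset_uniq.
- move=> v; rewrite mem_filter => /andP[/asboolP[x Ux [z Dz zx]] vc].
  apply: le_trans (enormB_trans x _ _) _.
  rewrite mulrDl lerD ?Ua// -zx (word_map_similarity (cutset_word_ok vc)).
  rewrite mulrC ler_pM ?enorm_ge0 ?(ltW (rate_gt0 cmin0 cb _ _))//.
    by apply: le_trans (enormD _ _) _; rewrite enormN lerD2l DD.
  exact: (cutset_rate_le cmin0 cb trho vc).
- move=> v w; rewrite !mem_filter => /andP[_ vc] /andP[_ wc].
  rewrite leNgt; apply: contra_neqN => vw.
  have r0 : 0 < rate c 0 v := rate_gt0 cmin0 cb 0 v.
  have vsim := word_map_similarity (cutset_word_ok vc).
  (* If the two images of [y0] are too close, the preimage [z] under the map of [v] of the image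
     along [w] is within [e] of [y0], hence in [O]. *)
  have [z zE] := similarity_surjective (word_map 0 w y0) r0 vsim.
  apply: (cutset_disjoint fO fOI vc wc _ Oy0 zE).
  apply: eO; rewrite -(ltr_pM2l r0) -vsim zE; apply: lt_le_trans vw _.
  rewrite mulrAC ler_wpM2r ?(ltW e0)//.
  exact: (cutset_rate_ge cmin0 cb crho vc).
Qed.

(** * Lower bound for the Hausdorff dimension *)

Section HausdorffLower.
Variables (s b : R).
Hypotheses (s0 : 0 < s) (b0 : 0 < b).
Hypothesis prodb : forall n, b <= \prod_(0 <= j < n) rate_sum N c s j.

Let meets (U : set 'rV[R]_d) w : bool :=
  `[< exists2 x, U x & (word_map 0 w @` Delta) x >].

(** The hypothesis of the mass distribution principle. Boundedly many words of the cutset at scale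
    [rho] meet [U], and by [prodb] each has mass at most the power [s] of [rho] divided by [b]. *)
Lemma mass_near : exists2 K : R, 0 < K & forall (U : set 'rV[R]_d) p rho t T,
  0 < rho -> rho <= 1 -> cmax ^+ t <= rho -> (t <= T)%N ->
  (forall x, U x -> enorm (x - p) <= rho) ->
  \sum_(w <- cutset N c T 0 0 | word_ok N 0 w && meets U w) mass N c s 0 w
    <= K * rho `^ s.
Proof.
have [K HK] := cutset_overlap 1.
exists (K.+1%:R / b) => [|U p rho t T rho0 rho1 trho tT Up]; first by rewrite
  divr_gt0.
have cr1 : cmin * rho <= 1.
  by rewrite mulr_ile1 ?(ltW cmin0) ?(ltW rho0)// (le_trans cmin_le_cmax)// ltW.
apply: (@le_trans _ _ (\sum_(v <- cutset N c t 0 rho | meets U v) mass N c s 0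
  v)).
  apply: (mass_cutset_le cmin0 cb N0 (ltW s0) tT) => v u vc /andP[vu].
  move=> /asboolP[x Ux xvu]; apply/asboolP; exists x => //.
  exact: (word_map_image_sub vu).
rewrite -big_filter; set l := [seq _ <- _ | _].
apply: (@le_trans _ _ (\sum_(v <- l) rho `^ s / b)).
  rewrite big_seq [leRHS]big_seq; apply: ler_sum => v.
  rewrite mem_filter => /andP[_ vc].
  have r0 : 0 < rate c 0 v by exact: (rate_gt0 cmin0 cb).
  rewrite (massE _ cmin0 cb _ _ (ltW s0)) add0n.
  rewrite ler_pM ?powR_ge0 ?invr_ge0 ?(le_trans (ltW b0) (prodb _))//.
    apply: ge0_ler_powR; rewrite ?nnegrE ?(ltW s0) ?(ltW rho0) ?(ltW r0)//.
    exact: (cutset_rate_le cmin0 cb trho vc).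
  by rewrite lef_pV2 ?posrE// (lt_le_trans b0 (prodb _)).
rewrite big_const_seq count_predT iter_addr_0 -[leLHS]mulr_natl [leRHS]mulrAC
  -[leRHS]mulrA.
rewrite ler_wpM2r ?divr_ge0 ?powR_ge0 ?(ltW b0)//.
rewrite ler_nat leqW// /l /meets; apply: (HK _ _ _ p) => // x /Up.
by rewrite mul1r.
Qed.

(** Makes room for an open neighbourhood, also when the diameter is 0, at the cost of [eta] in the
    power [s]. *)
Let enlarge (A : set 'rV[R]_d) (eta : R) : 0 < eta -> (diam A <= (2^-1)%:E)%E ->
  exists rho, [/\ fine (diam A) < rho, rho <= 1 &
    rho `^ s <= fine (diam A) `^ s + eta].
Proof.
move=> eta0 A2; have A0 := diam_ge0 A.
have Afin : diam A \is a fin_num.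
  by rewrite ge0_fin_numE// (le_lt_trans A2)// ltry.
set D := fine (diam A).
have D0 : 0 <= D by rewrite fine_ge0.
have D2 : D <= 2^-1 by rewrite -lee_fin fineK.
have DsE : D = (D `^ s) `^ s^-1 by rewrite -powRrM divff ?gt_eqF// powRr1.
have p0 : 0 <= D `^ s + eta by rewrite addr_ge0 ?powR_ge0// ltW.
exists (Num.min 1 ((D `^ s + eta) `^ s^-1)); split.
- rewrite lt_min; apply/andP; split.
    by apply: le_lt_trans D2 _; rewrite invf_lt1// ltr1n.
  rewrite {1}DsE; apply: gt0_ltr_powR; rewrite ?nnegrE ?invr_gt0 ?powR_ge0//.
  by rewrite ltrDl.
- by rewrite ge_min lexx.
- apply: (@le_trans _ _ (((D `^ s + eta) `^ s^-1) `^ s)).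
    apply: ge0_ler_powR; rewrite ?nnegrE ?powR_ge0 ?(ltW s0)//.
      by rewrite le_min ler01 powR_ge0.
    by rewrite ge_min lexx orbT.
  by rewrite -powRrM mulVf ?gt_eqF// powRr1.
Qed.

(** For diameters below 1 the power decreases in the exponent, so one bound at [s] serves all
    [s' <= s]. Diameter 0 is harmless because [s] is positive. *)
Let gauge_ge s' (A : set 'rV[R]_d) : 0 <= s' -> s' <= s ->
  (diam A <= (2^-1)%:E)%E -> ((fine (diam A) `^ s)%:E <= hausdorff_gauge s'
    A)%E.
Proof.
move=> s'0 s's A2; have A0 := diam_ge0 A.
have Afin : diam A \is a fin_num.
  by rewrite ge0_fin_numE// (le_lt_trans A2)// ltry.
have [DA|] := eqVneq (fine (diam A)) 0.
  by rewrite DA powR0 ?gt_eqF// hausdorff_gauge_ge0.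
move=> DA; rewrite /hausdorff_gauge; case: asboolP => [AE|_].
  move: DA; rewrite AE /diam setX0 image_set0 ereal_sup0 maxeNy/= eqxx//.
rewrite -[X in poweR X]fineK// poweR_EFin lee_fin; apply: ger_powR => //.
rewrite lt_neqAle eq_sym DA fine_ge0//=.
by rewrite -lee_fin fineK// (le_trans A2)// lee_fin invf_le1// ler1n.
Qed.

(* The cover is enlarged to an open one, reduced to a finite one by
   compactness, and weighed by the masses of the words of a large level. *)
Lemma hausdorff_premeasure_gt0 : exists2 kappa : R, 0 < kappa &
  forall s', 0 <= s' -> s' <= s -> (kappa%:E <= hausdorff_premeasure s' 2^-1
    F)%E.
Proof.
have [K K0 HK] := mass_near.
(* The total mass 1 will bound the sum of the gauges below by [1 / K - eps], the [eta i] costing at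
   most [eps] together; for this value the bound is [eps] itself. *)
pose eps := (2 * K)^-1.
have eps0 : 0 < eps by rewrite invr_gt0 mulr_gt0.
exists eps => // s' s'0 s's; apply: le_ereal_inf_tmp => _ [U [FU U2] <-].
pose eta i := eps / (2 ^+ i.+1).
have eta0 i : 0 < eta i by rewrite divr_gt0 ?exprn_gt0.
have [rho rhoP] := choice (fun i => enlarge (eta0 i) (U2 i)).
have D0 i : 0 <= fine (diam (U i)) by rewrite fine_ge0// diam_ge0.
have rho0 i : 0 < rho i by have [+ _ _] := rhoP i; exact: le_lt_trans.
have ex_t i : exists t : nat, cmax ^+ t <= rho i.
  have cmax0 : 0 <= cmax by exact: le_trans (ltW cmin0) cmin_le_cmax.
  have : (fun n => cmax ^+ n) @ \oo --> 0 by apply: cvg_expr; rewrite ger0_norm.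
  move=> /cvgrPdist_lt/(_ _ (rho0 i))[n _ /(_ n (leqnn n))].
  by rewrite sub0r normrN ger0_norm ?exprn_ge0// => /ltW; exists n.
have [t tP] := choice ex_t.
(* With this radius, every point of [V i] is within [rho i] of any given point of [U i]. *)
pose V i : set 'rV[R]_d := \bigcup_(u in U i)
  [set y | enorm (u - y) < rho i - fine (diam (U i))].
have /= := moran_set_compact; rewrite compact_cover => /(_ _ setT V).
case=> [i _|x /FU[i _ Uix]|I _ IF].
- by apply: bigcup_open => u _; exact: enorm_open.
- exists i => //; exists x => //=; rewrite subrr enorm0 subr_gt0.
  by have [] := rhoP i.
pose T := (\max_(i <- enum_fset I) t i)%N.
have tT i : i \in I -> (t i <= T)%N.
  by move=> iI; rewrite /T (big_rem i)//= leq_maxl.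
have le1 : 1 <= \sum_(i <- enum_fset I) K * rho i `^ s.
  rewrite -(sum_mass cmin0 cb N0 T 0 0 (ltW s0)).
  apply: (@le_trans _ _ (\sum_(i <- enum_fset I)
     \sum_(w <- cutset N c T 0 0 | word_ok N 0 w && meets (V i) w) mass N c s 0
       w)).
    (* After exchanging the sums, each word is counted at least once: its cylinder meets [F], at a
       point of some [V i]. *)
    under [leRHS]eq_bigr do rewrite big_mkcond.
    rewrite exchange_big/= big_seq [leRHS]big_seq; apply: ler_sum => w wc.
    have wok := cutset_word_ok wc.
    have [x Fx wx] := moran_set_cylinder wok; have [i iI Vix] := IF _ Fx.
    rewrite (big_rem i)//= wok ifT; last by apply/asboolP; exists x.
    rewrite lerDl sumr_ge0// => j _; case: ifP => // _.
    exact: (mass_ge0 cmin0 cb N0 _ _ (ltW s0)).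
  rewrite big_seq [leRHS]big_seq; apply: ler_sum => i iI.
  have [Ui0|/set0P[p Up]] := eqVneq (U i) set0.
    rewrite big1 ?mulr_ge0 ?powR_ge0 ?(ltW K0)// => w /andP[_].
    by move=> /asboolP[x [u]]; rewrite Ui0.
  have [_ rho1 _] := rhoP i.
  apply: (HK _ p _ (t i)) => //; first exact: tT.
  move=> x [u Uu /= ux]; rewrite enormBC; apply: le_trans (enormB_trans u _ _)
    _.
  rewrite -(subrK (fine (diam (U i))) (rho i)) addrC lerD ?(ltW ux)//.
  rewrite -lee_fin fineK; first exact: le_diam.
  by rewrite ge0_fin_numE ?diam_ge0// (le_lt_trans (U2 i))// ltry.
pose n := (\max_(i <- enum_fset I) i.+1)%N.
apply: (@le_trans _ _ (\sum_(0 <= i < n) hausdorff_gauge s' (U i))%E); last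
  first.
  by apply: nneseries_lim_ge => *; exact: hausdorff_gauge_ge0.
apply: (@le_trans _ _ (\sum_(0 <= i < n) (fine (diam (U i)) `^ s)%:E)%E); last
  first.
  by apply: lee_sum => i _; exact: gauge_ge.
rewrite sumEFin lee_fin.
pose g i := K * rho i `^ s.
have g0 i : 0 <= g i by rewrite mulr_ge0 ?powR_ge0 ?(ltW K0).
have le2 : \sum_(i <- enum_fset I) g i <= \sum_(0 <= i < n) g i.
  have pe : perm_eq (enum_fset I) [seq i <- index_iota 0 n | i \in enum_fset I].
    apply: uniq_perm; rewrite ?filter_uniq ?iota_uniq ?enum_fset_uniq// => i.
    rewrite mem_filter mem_index_iota/= andb_idr// => iI.
    by rewrite /n (big_rem i)//= leq_max ltnSn.
  rewrite (perm_big _ pe)/= big_filter.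
  by rewrite [leRHS](bigID (fun i => i \in enum_fset I))/= lerDl sumr_ge0.
have le3 : \sum_(0 <= i < n) g i <=
    K * (\sum_(0 <= i < n) fine (diam (U i)) `^ s + \sum_(0 <= i < n) eta i).
  rewrite -big_split mulr_sumr/=; apply: ler_sum => i _.
  by rewrite ler_wpM2l ?(ltW K0)//; have [] := rhoP i.
have etaE m : \sum_(0 <= i < m) eta i = eps - eps / 2 ^+ m.
  elim: m => [|m IH]; first by rewrite big_geq// expr0 divr1 subrr.
  rewrite big_nat_recr//= IH /eta exprS; field.
  by rewrite expf_neq0.
have := le_trans le1 (le_trans le2 le3).
rewrite mulrC -ler_pdivrMr// etaE => le4.
have -> : eps = 1 / K - eps by rewrite /eps; field; rewrite gt_eqF.
rewrite lerBlDr; apply: le_trans le4 _; rewrite lerD2l gerBl.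
by rewrite divr_ge0 ?exprn_ge0 ?(ltW eps0).
Qed.

Lemma dim_H_moran_set_ge : (s%:E <= dim_H F)%E.
Proof.
have [kappa kappa0 Hk] := hausdorff_premeasure_gt0.
apply: le_ereal_inf_tmp => _ [s' [s'0 Hs'] <-].
rewrite lee_fin leNgt; apply/negP => s's.
have : (kappa%:E <= hausdorff_measure s' F)%E.
  apply: le_trans (Hk _ s'0 (ltW s's)) _; apply: ereal_sup_ubound.
  by exists 2^-1; rewrite //= invr_gt0.
by rewrite Hs' lee_fin leNgt kappa0.
Qed.

End HausdorffLower.

(** * Upper bound for the quasi-Assouad spectrum *)

Section QuasiAssouadUpper.
Variables (s delta : R).
Hypotheses (s0 : 0 <= s) (delta0 : 0 < delta).
Hypothesis prod_le : forall eps : R, 0 < eps -> exists C : R, forall k n,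
  (k <= n)%N -> \prod_(k <= j < n) rate_sum N c s j <= expR (eps * n%:R + C).

Let cmax0 : 0 < cmax. Proof. exact: lt_le_trans cmin_le_cmax. Qed.

Let cmin1 : cmin < 1. Proof. exact: le_lt_trans cmin_le_cmax cmax1. Qed.

Let ex_expr_le (e : R) : 0 < e -> exists t : nat, cmax ^+ t <= e.
Proof.
move=> e0.
have : (fun n => cmax ^+ n) @ \oo --> 0 by apply: cvg_expr; rewrite gtr0_norm.
move=> /cvgrPdist_lt/(_ _ e0)[n _ /(_ n (leqnn n))].
by rewrite sub0r normrN ger0_norm ?exprn_ge0 ?(ltW cmax0)// => /ltW; exists n.
Qed.

(** The masses of the words below [v] add up to 1 and each is at least [m], so there are at most
    [1 / m] words. The factor allowed by [prod_le] is exponential in the level, which is of order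
    the logarithm of [1 / rho]; this gives the power [- gamma] of [rho]. *)
Let size_cutset_le (gamma : R) : 0 < gamma -> exists2 C : R, 0 < C &
  forall v t rho, 0 < rho -> cmin * rho <= 1 ->
    cmax ^+ t <= rho / rate c 0 v -> rho <= rate c 0 v ->
  (size (cutset N c t (size v) (rho / rate c 0 v)))%:R <=
    C * (rate c 0 v / rho) `^ s * rho `^ (- gamma).
Proof.
move=> gamma0.
(* With this growth rate, the factor at level [n] is the power [- gamma] of [cmax ^+ n]. *)
have eps0 : 0 < gamma * - ln cmax.
  by rewrite mulr_gt0// oppr_gt0 ln_lt0// cmax0.
have [C HC] := prod_le eps0.
exists (cmin `^ (- s) * expR C * cmin `^ (- gamma)).
  by rewrite !mulr_gt0 ?powR_gt0 ?expR_gt0.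
move=> v t rho rho0 crho trho rhov.
set rv := rate c 0 v; have rv0 : 0 < rv by exact: (rate_gt0 cmin0 cb).
have q0 : 0 < rho / rv by rewrite divr_gt0.
have q1 : rho / rv <= 1 by rewrite ler_pdivrMr// mul1r.
have cq1 : cmin * (rho / rv) <= 1.
  by rewrite mulr_ile1 ?(ltW cmin0) ?(ltW q0) ?(ltW cmin1).
pose m := (cmin * (rho / rv)) `^ s * (expR C * (cmin * rho) `^ (- gamma))^-1.
have m0 : 0 < m.
  by rewrite mulr_gt0 ?invr_gt0// ?mulr_gt0 ?expR_gt0// powR_gt0// mulr_gt0.
have mle u : u \in cutset N c t (size v) (rho / rv) -> m <= mass N c s (size v)
  u.
  move=> uc; have ru0 : 0 < rate c (size v) u by exact: (rate_gt0 cmin0 cb).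
  have ru : cmin * (rho / rv) <= rate c (size v) u.
    exact: (cutset_rate_ge cmin0 cb cq1 uc).
  rewrite (massE _ cmin0 cb _ _ s0).
  have S0 : 0 < \prod_(size v <= j < size v + size u) rate_sum N c s j.
    by apply: prodr_gt0 => j _; exact: (rate_sum_gt0 cmin0 cb N0).
  rewrite ler_pM ?powR_ge0 ?invr_ge0 ?mulr_ge0 ?powR_ge0 ?expR_ge0//.
    apply: ge0_ler_powR; rewrite ?nnegrE ?(ltW ru0)//.
    by rewrite mulr_ge0 ?(ltW cmin0) ?(ltW q0).
  have B0 : 0 < expR C * (cmin * rho) `^ (- gamma).
    by rewrite mulr_gt0 ?expR_gt0// powR_gt0// mulr_gt0.
  rewrite lef_pV2 ?posrE//.
  apply: le_trans (HC _ _ (leq_addr _ _)) _.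
  rewrite expRD mulrC ler_wpM2l ?expR_ge0//.
  set n := (_ + _)%N.
  have -> : expR (gamma * - ln cmax * n%:R) = (cmax ^+ n) `^ (- gamma).
    rewrite /powR expf_eq0 (gt_eqF cmax0) andbF lnXn//; congr expR.
    by rewrite -[_ *+ n]mulr_natr; ring.
  rewrite !powRN lef_pV2 ?posrE ?powR_gt0 ?exprn_gt0 ?mulr_gt0//.
  apply: ge0_ler_powR; rewrite ?nnegrE ?(ltW gamma0) ?mulr_ge0 ?exprn_ge0 ?(ltW
    cmin0) ?(ltW rho0) ?(ltW cmax0)//.
  (* [cmax ^+ n] dominates the rate of [v ++ u], which is at least [cmin * rho]. *)
  have := rate_le cmin0 cb 0 (v ++ u); rewrite size_cat -/n; apply: le_trans.
  by rewrite rate_cat add0n -/rv [leRHS]mulrC -ler_pdivrMr// -mulrA.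
have le1 : (size (cutset N c t (size v) (rho / rv)))%:R * m <= 1.
  rewrite -[leRHS](sum_mass cmin0 cb N0 t (size v) (rho / rv) s0).
  apply: (@le_trans _ _ (\sum_(u <- cutset N c t (size v) (rho / rv)) m)).
    by rewrite big_const_seq count_predT iter_addr_0 -[leRHS]mulr_natl.
  by rewrite big_seq [leRHS]big_seq; apply: ler_sum.
move: le1; rewrite -ler_pdivlMr// mul1r => /le_trans; apply.
rewrite /m invfM invrK -powRN.
have -> : cmin * (rho / rv) = cmin * (rv / rho)^-1 by rewrite invf_div.
rewrite [(cmin * _^-1) `^ _]powRM 1?[(cmin * rho) `^ _]powRM ?(ltW cmin0)
  ?invr_ge0 ?divr_ge0 ?(ltW rho0) ?(ltW rv0)//.
have -> : ((rv / rho)^-1) `^ (- s) = (rv / rho) `^ s.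
  by rewrite -(powR_inv1 (ltW (divr_gt0 rv0 rho0))) -powRrM mulrNN mul1r.
rewrite le_eqVlt; apply/orP; left; apply/eqP; ring.
Qed.

(** A ball of radius [rho] meets boundedly many cylinders of scale [rho / D]; each is cut along the
    cutset of scale [r * eta] into pieces of diameter at most [r], counted by [size_cutset_le]. *)
Lemma qA_spectrum_moran_set_le : (qA_spectrum delta F <= s%:E)%E.
Proof.
apply/lee_addgt0Pr => beta beta0; rewrite -EFinD.
apply: ereal_inf_lbound; exists (s + beta) => //.
split; first by rewrite addr_ge0// ltW.
have [D1 D10 DD1] := compact_enorm_le Delta_compact.
pose D := D1 + D1 + 1.
have D_ge1 : 1 <= D by rewrite lerDr addr_ge0// ltW.
have D0 : 0 < D by exact: lt_le_trans D_ge1.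
have DD x y : Delta x -> Delta y -> enorm (x - y) <= D.
  move=> /DD1 Dx /DD1 Dy; apply: le_trans (enormD _ _) _.
  by rewrite enormN /D (le_trans (lerD Dx Dy))// lerDl.
have [K HK] := cutset_overlap D.
have d1 : 0 < 1 + delta by rewrite ltr_wpDl.
(* As [r] is at most the power [1 + delta] of [rho], the power [- (delta / (1 + delta))] of [r] is
   at most [rho / r]; hence the power [- gamma] of [r] costs at most the power [beta] of
   [rho / r]. *)
pose gamma := beta * (delta / (1 + delta)).
have gamma0 : 0 < gamma by rewrite mulr_gt0// divr_gt0.
have [C C0 HC] := size_cutset_le gamma0.
pose E := D `^ delta; have E0 : 0 < E by rewrite powR_gt0.
have E1 : 1 <= E by rewrite /E -[leLHS](powRr0 D) ler_powR// ltW.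
(* [D * eta <= 1] bounds the diameters of the small cylinders by [r], and [r <= rho * E] gives
   [r1 <= cmin * R1], so that the second cutset starts below the rate of every word of the first. *)
pose eta := cmin / (D * E); have eta0 : 0 < eta by rewrite divr_gt0// mulr_gt0.
have etaD : D * eta <= 1.
  rewrite /eta; have -> : D * (cmin / (D * E)) = cmin / E by field; rewrite
    !gt_eqF.
  by rewrite ler_pdivrMr// mul1r (le_trans (ltW cmin1)).
pose C1 := C * ((D * eta)^-1) `^ s * eta `^ (- gamma).
have C10 : 0 < C1.
  by rewrite mulr_gt0 ?powR_gt0// mulr_gt0// powR_gt0// invr_gt0 mulr_gt0.
exists (K.+1%:R * C1); first by rewrite mulr_gt0.
move=> r rho r0 rho0 rrho rhoF.
(* Otherwise, as [D >= 1], the power [1 + delta] of [rho] would exceed [D] and hence the diameter of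
   [F]. *)
have rhoD : rho <= D.
  rewrite leNgt; apply/negP => Drho.
  have : rho `^ (1 + delta) <= D.
    rewrite -lee_fin; apply: le_trans rhoF _; apply: diam_le; first exact: ltW.
    by move=> x y /moran_set_sub Dx /moran_set_sub Dy; exact: DD.
  rewrite leNgt => /negP; apply; apply: (lt_le_trans Drho).
  move/ltW: Drho => Drho.
  rewrite -[leLHS](powRr1 (ltW rho0)) ler_powR ?lerDl ?(ltW delta0)//.
  exact: le_trans D_ge1 Drho.
pose R1 := rho / D; pose r1 := r * eta.
have R10 : 0 < R1 by rewrite divr_gt0.
have R11 : R1 <= 1 by rewrite ler_pdivrMr// mul1r.
have r10 : 0 < r1 by rewrite mulr_gt0.
have r1R1 : r1 <= cmin * R1.
  have rE : r <= rho * E.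
    apply: le_trans rrho _; rewrite powRD; last by rewrite (gt_eqF rho0)
      implybT.
    rewrite powRr1 ?(ltW rho0)// ler_wpM2l ?(ltW rho0)//.
    by apply: ge0_ler_powR; rewrite ?nnegrE ?(ltW delta0) ?(ltW rho0) ?(ltW D0).
  rewrite /r1 /R1 /eta mulrA ler_pdivrMr ?mulr_gt0//.
  have -> : cmin * (rho / D) * (D * E) = rho * E * cmin by field; rewrite
    gt_eqF.
  by rewrite ler_wpM2r// ltW.
have r11 : r1 <= 1.
  by apply: le_trans r1R1 _; rewrite mulr_ile1 ?(ltW cmin0) ?(ltW R10) ?(ltW
    cmin1).
have cr11 : cmin * r1 <= 1.
  by rewrite mulr_ile1 ?(ltW cmin0) ?(ltW r10) ?(ltW cmin1).
have cR11 : cmin * R1 <= 1.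
  by rewrite mulr_ile1 ?(ltW cmin0) ?(ltW R10) ?(ltW cmin1).
have [t tR] := ex_expr_le R10; have [t' tr] := ex_expr_le r10.
apply: ge_ereal_sup => _ [x0 Fx0 <-].
pose l := [seq v <- cutset N c t 0 R1 |
  `[< exists2 x, eball x0 rho x & (word_map 0 v @` Delta) x >] ].
have lK : (size l <= K)%N.
  apply: (HK _ _ _ x0) => // x; rewrite /eball/= enormBC => /ltW xr.
  by rewrite /R1 mulrC divfK ?gt_eqF.
pose bd := C1 * (rho / r) `^ (s + beta); pose m := Num.truncn bd.
have bd0 : 0 <= bd by rewrite mulr_ge0 ?powR_ge0 ?(ltW C10).
have cov : covered r (size l * m) (eball x0 rho `&` F).
  apply: (@covered_bigcup _ _ _ _ (fun v => \bigcup_(u in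
     [set` cutset N c t' (size v) (r1 / rate c 0 v)]) (word_map 0 (v ++ u) @`
       Delta))).
  - exact: ltW.
  - move=> v; rewrite mem_filter => /andP[_ vc].
    have vR : rate c 0 v <= R1 := cutset_rate_le cmin0 cb tR vc.
    have Rv : cmin * R1 <= rate c 0 v := cutset_rate_ge cmin0 cb cR11 vc.
    have rv0 : 0 < rate c 0 v by exact: (rate_gt0 cmin0 cb).
    have trv : cmax ^+ t' <= r1 / rate c 0 v.
      by apply: le_trans tr _; rewrite ler_pdivlMr// ler_piMr ?(ltW r10)//
        (le_trans vR).
    apply: (@covered_leq _ _ _ (size (cutset N c t' (size v) (r1 / rate c 0 v))
      * 1)).
    + exact: ltW.
    + rewrite muln1 truncn_ge_nat//.
      apply: le_trans (HC _ _ _ r10 cr11 trv (le_trans r1R1 Rv)) _.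
      have e1 : (rate c 0 v / r1) `^ s <= ((D * eta)^-1) `^ s * (rho / r) `^ s.
        have h1 : 0 <= (D * eta)^-1 by rewrite invr_ge0 ltW// mulr_gt0.
        have h2 : 0 <= rho / r by rewrite ltW// divr_gt0.
        rewrite -(powRM _ h1 h2).
        have -> : (D * eta)^-1 * (rho / r) = R1 / r1.
          by rewrite /R1 /r1; field; rewrite !gt_eqF.
        have q1 : 0 <= rate c 0 v / r1 by apply: divr_ge0; exact: ltW.
        have q2 : 0 <= R1 / r1 by apply: divr_ge0; exact: ltW.
        apply: ge0_ler_powR => //.
        by rewrite ler_wpM2r// invr_ge0 ltW.
      have e2 : r1 `^ (- gamma) <= eta `^ (- gamma) * (rho / r) `^ beta.
        rewrite /r1 [r * _]mulrC (@powRM _ eta r) ?(ltW eta0) ?(ltW r0)//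
          ler_wpM2l ?powR_ge0//.
        have -> : - gamma = (- (delta / (1 + delta))) * beta by rewrite /gamma;
          ring.
        rewrite powRrM; apply: ge0_ler_powR; rewrite ?nnegrE ?powR_ge0 ?(ltW
          beta0) ?(divr_ge0 (ltW rho0) (ltW r0))//.
        rewrite ler_pdivlMr// -[X in _ * X](powRr1 (ltW r0)) -powRD; last first.
          by rewrite (gt_eqF r0) implybT.
        have -> : - (delta / (1 + delta)) + 1 = (1 + delta)^-1 by field;
          rewrite gt_eqF.
        have -> : rho = (rho `^ (1 + delta)) `^ (1 + delta)^-1.
          by rewrite -powRrM divff ?gt_eqF// powRr1// ltW.
        by apply: ge0_ler_powR; rewrite ?nnegrE ?powR_ge0 ?invr_ge0 ?(ltW d1)
          ?(ltW r0).
      apply: (@le_trans _ _ (C * (((D * eta)^-1) `^ s * (rho / r) `^ s) *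
          (eta `^ (- gamma) * (rho / r) `^ beta))).
        by rewrite ler_pM ?mulr_ge0 ?powR_ge0 ?(ltW C0)// ler_wpM2l ?(ltW C0).
      rewrite /bd /C1 powRD; last first.
        by rewrite (gt_eqF (divr_gt0 rho0 r0)) implybT.
      rewrite le_eqVlt; apply/orP; left; apply/eqP; ring.
    + apply: (@covered_bigcup _ _ _ _ (fun u => word_map 0 (v ++ u) @` Delta)).
      * exact: ltW.
      * move=> u uc; exists (fun=> word_map 0 (v ++ u) @` Delta); split; last
        first.
          by move=> x vx; exists ord0.
        move=> _; apply: diam_le; first exact: ltW.
        move=> _ _ [x Dx <-] [y Dy <-].
        have vuok : word_ok N 0 (v ++ u).
          by rewrite word_ok_cat add0n (cutset_word_ok vc) (cutset_word_ok uc).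
        rewrite (word_map_similarity vuok) rate_cat add0n.
        have ur : rate c (size v) u <= r1 / rate c 0 v.
          exact: (cutset_rate_le cmin0 cb trv uc).
        apply: (@le_trans _ _ (r1 * D)).
          rewrite ler_pM ?enorm_ge0 ?DD ?mulr_ge0 ?(ltW rv0) ?(ltW (rate_gt0
            cmin0 cb _ _))//.
          by rewrite mulrC -ler_pdivlMr.
        by rewrite /r1 -mulrA ler_piMr ?(ltW r0)// mulrC.
      * by move=> x [u uc vx]; exists u.
  - move=> x [xB Fx].
    have [v [u [vc uc vx vux]]] :=
      moran_set_prefix t t' R1 (fun v => r1 / rate c 0 v) Fx.
    exists v; last by exists u.
    by rewrite mem_filter vc andbT; apply/asboolP; exists x.
apply: le_trans (cover_number_le cov) _; rewrite lee_fin -mulrA natrM.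
rewrite ler_pM// ?ler_nat ?leqW// /m truncn_le; exact: bd0.
Qed.

End QuasiAssouadUpper.

(* According to the sign of [m], either the products of the [rate_sum]s stay
   away from zero or their growth is subexponential. *)
Lemma qA_spectrum_moran_set delta : 0 < delta ->
  (forall q : rat, 0 <= ratr q :> R -> exists m : R, forall eps : R, 0 < eps ->
    exists C : R, forall n,
    `|\sum_(0 <= j < n) ln (rate_sum N c (ratr q) j) - m * n%:R| <= eps * n%:R
      + C) ->
  qA_spectrum delta F = dim_H F.
Proof.
move=> delta0 law; apply/eqP; rewrite eq_le; apply/andP; split; last first.
  by apply: dim_H_le_qA_spectrum => //; exact: moran_set_compact.
have dim0 : (0 <= dim_H F)%E.
  by apply: le_ereal_inf_tmp => _ [s [s0 _] <-]; rewrite lee_fin.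
(* Rational exponents suffice by density, so that countably many almost sure events are enough. *)
suff lt_dim q : (dim_H F < (ratr q)%:E)%E -> (qA_spectrum delta F <= (ratr
  q)%:E)%E.
  move: dim0 lt_dim; case: (dim_H F) => [x| |] // x0 lt_dim; last exact: leey.
  apply/lee_addgt0Pr => e e0; rewrite -EFinD.
  have [q] : exists q : rat, ratr q \in `]x, (x + e)[.
    by apply: rat_in_itvoo; rewrite ltrDl.
  rewrite in_itv/= => /andP[xq qe]; apply: le_trans (lt_dim q _) _.
    by rewrite lte_fin.
  by rewrite lee_fin ltW.
move=> dq; have q0 : 0 < ratr q :> R by rewrite -lte_fin (le_lt_trans dim0).
have [m Hm] := law q (ltW q0).
pose L n : R := \sum_(0 <= j < n) ln (rate_sum N c (ratr q) j).
have S0 j : 0 < rate_sum N c (ratr q) j := rate_sum_gt0 cmin0 cb N0 j (ltW q0).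
have prodE i n : (i <= n)%N ->
    \prod_(i <= j < n) rate_sum N c (ratr q) j = expR (L n - L i).
  move=> i_n; rewrite /L (big_cat_nat (leq0n i) i_n)/= addrAC subrr add0r
    expR_sum.
  by apply: eq_bigr => j _; rewrite lnK ?posrE.
have [m0|m0] := ltP 0 m.
  (* With [eps = m] the linear terms cancel and the sums of logarithms are at least [- C]. *)
  have [C HC] := Hm _ m0.
  suff : ((ratr q)%:E <= dim_H F)%E by rewrite leNgt dq.
  apply: (@dim_H_moran_set_ge _ (expR (- C))) => // [|n]; first exact: expR_gt0.
  rewrite (prodE 0%N n)// ler_expR /L [X in _ - X]big_geq// subr0.
  by have := HC n; rewrite ler_norml => /andP[+ _]; lra.
apply: (qA_spectrum_moran_set_le (ltW q0) delta0) => e e0.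
(* Half of [e] for each of the two partial sums; their difference has main term [m * (n - i)], which
   is at most 0. *)
have [C HC] := Hm _ (divr_gt0 e0 (ltr0Sn R 1)).
exists (2 * C) => i n i_n; rewrite prodE// ler_expR.
have := HC n; have := HC i; rewrite -/(L _) -/(L n) !ler_norml.
move=> /andP[h1 _] /andP[_ h2].
have h3 : i%:R <= n%:R :> R by rewrite ler_nat.
have : 0 <= e / 2 * (n%:R - i%:R) by rewrite mulr_ge0 ?subr_ge0// ltW//
  divr_gt0.
have : 0 <= - m * (n%:R - i%:R) by rewrite mulr_ge0 ?subr_ge0 ?oppr_ge0.
by rewrite !mulrBr; move: h1 h2; lra.
Qed.

End Moran.

(** * A strong law of large numbers *)

Lemma exists_square_between n : exists k, (k ^ 2 <= n < k.+1 ^ 2)%N.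
Proof.
elim: n => [|n [k /andP[kn nk]]]; first by exists 0%N.
have [nk1|nk1] := ltnP n.+1 (k.+1 ^ 2).
  by exists k; rewrite nk1 (leq_trans kn).
by exists k.+1; rewrite nk1 (leq_ltn_trans nk)// ltn_sqr.
Qed.

(* Between consecutive squares a bounded sequence adds at most
   [2 * k * K <= eps * k ^ 2 + K ^ 2 / eps] to its partial sums. *)
Lemma sum_le_of_squares (R : realType) (a : nat -> R) (K : R) :
  (forall j, `|a j| <= K) ->
  (forall eps, 0 < eps -> exists k0 : nat, forall k, (k0 <= k)%N ->
    `|\sum_(0 <= j < k.+1 ^ 2) a j| <= eps * (k.+1 ^ 2)%:R) ->
  forall eps, 0 < eps -> exists C : R, forall n,
    `|\sum_(0 <= j < n) a j| <= eps * n%:R + C.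
Proof.
move=> aK aS e e0; have e20 : 0 < e / 2 by rewrite divr_gt0.
have K0 : 0 <= K := le_trans (normr_ge0 _) (aK 0%N).
have [k0 k0P] := aS _ e20.
(* The first term bounds the sums before the estimate on squares sets in; the second comes from
   completing the square in [2 * K * x]. *)
exists (K * (k0.+1 ^ 2)%:R + 2 * K ^+ 2 / e) => n.
have sumK m p : `|\sum_(m <= j < p) a j| <= K * (p - m)%:R.
  apply: le_trans (ler_norm_sum _ _ _) _.
  by apply: le_trans (ler_sum _ (fun j _ => aK j)) _; rewrite sumr_const_nat
    mulr_natr.
have K2e : 0 <= 2 * K ^+ 2 / e by rewrite divr_ge0 ?mulr_ge0 ?sqr_ge0 ?(ltW e0).
have [k /andP[kn nk]] := exists_square_between n.
have [kk0|] := leqP k k0.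
  apply: le_trans (sumK _ _) _; rewrite subn0.
  have : K * n%:R <= K * (k0.+1 ^ 2)%:R.
    by rewrite ler_wpM2l// ler_nat (leq_trans (ltnW nk))// leq_sqr.
  have : 0 <= e * n%:R by rewrite mulr_ge0 ?(ltW e0).
  by lra.
case: k kn nk => // k kn nk; rewrite ltnS => k0k.
rewrite (big_cat_nat (leq0n _) kn)/=.
apply: le_trans (ler_normD _ _) _.
have := k0P k k0k; have := sumK (k.+1 ^ 2)%N n.
have : (n - k.+1 ^ 2 <= 2 * k.+1)%N by move: nk; rewrite !expnS !expn0; lia.
rewrite -(ler_nat R) natrM => /(ler_wpM2l K0).
have : (k.+1 ^ 2)%:R <= n%:R :> R by rewrite ler_nat.
rewrite natrX; set x := k.+1%:R; set y := n%:R; set z := _%:R.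
have : 0 <= K * (k0.+1 ^ 2)%:R by rewrite mulr_ge0.
have : 2 * K * x <= e / 2 * x ^+ 2 + 2 * K ^+ 2 / e.
  rewrite -subr_ge0.
  have -> : e / 2 * x ^+ 2 + 2 * K ^+ 2 / e - 2 * K * x = (e * x - 2 * K) ^+ 2
    / (2 * e).
    by field; rewrite gt_eqF.
  by rewrite divr_ge0 ?sqr_ge0 ?mulr_ge0 ?(ltW e0).
move=> h1 h2 h3 h4 h5 h6.
have : e / 2 * x ^+ 2 <= e / 2 * y by rewrite ler_wpM2l ?(ltW e20).
by lra.
Qed.

Section StrongLaw.
Context d d' (T : measurableType d) (S : measurableType d') (R : realType).
Variables (P : probability T R) (mu : probability S R) (X : nat -> T -> S).
Hypothesis mX : forall i, measurable_fun setT (X i).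
Hypothesis X_indep : forall i j A B, i != j -> measurable A -> measurable B ->
  P (X i @^-1` A `&` X j @^-1` B) = (mu A * mu B)%E.

Let bounded_integrable d1 (U : measurableType d1) (Q : probability U R)
    (u : U -> R) (C : R) :
  measurable_fun setT u -> (forall x, `|u x| <= C) -> Q.-integrable setT (EFin
    \o u).
Proof.
move=> mu' uC; apply: measurable_bounded_integrable => //.
  by apply: le_lt_trans (probability_le1 Q measurableT) _; rewrite ltry.
by exists C; split; rewrite ?num_real// => D CD x _ /=; rewrite (le_trans (uC
  x))// ltW.
Qed.

Section Centered.
Variables (h : S -> R) (K : R).
Hypotheses (mh : measurable_fun setT h) (hK : forall x, `|h x| <= K).
Hypothesis h0 : (\int[mu]_x (h x)%:E = 0)%E.

Let K0 : 0 <= K. Proof. exact: le_trans (normr_ge0 _) (hK point). Qed.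

(** By independence the pair [(X i, X j)] has law [mu \x mu], and Fubini reduces the claim to the
    vanishing mean of [h]. *)
Let uncorrelated i j : i != j -> (\int[P]_x (h (X i x) * h (X j x))%:E = 0)%E.
Proof.
move=> ij.
pose Y0 x := (X i x, X j x).
have mY : measurable_fun setT Y0 by exact: measurable_fun_pair.
pose Y : {mfun T >-> (S * S)%type} :=
  HB.pack Y0 (isMeasurableFun.Build _ _ _ _ _ mY).
pose F (z : S * S) : \bar R := (h z.1 * h z.2)%:E.
have mF' : measurable_fun setT (fun z : S * S => h z.1 * h z.2).
  by apply: measurable_funM; apply: measurableT_comp.
have mF : measurable_fun setT F by apply/measurable_EFinP.
have FK z : `|h z.1 * h z.2| <= K * K by rewrite normrM ler_pM.
have Fint (Q : probability _ R) : Q.-integrable setT F.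
  exact: bounded_integrable mF' FK.
have -> : (\int[P]_x (h (X i x) * h (X j x))%:E = \int[P]_(x in Y @^-1` setT)
  (F \o Y) x)%E.
  by rewrite preimage_setT.
rewrite -integral_pushforward//; last first.
  rewrite preimage_setT.
  apply: (@bounded_integrable _ _ _ (fun x => h (X i x) * h (X j x)) (K * K)).
    by apply: measurable_funM; apply: measurableT_comp.
  by move=> x; exact: (FK (X i x, X j x)).
rewrite (eq_measure_integral (mu \x mu)%E); last first.
  move=> A mA _; apply/esym; apply: product_measure_unique => // B C mB mC.
  by rewrite -(X_indep ij mB mC).
rewrite -integral12_prod_meas1//; last first.
  apply: (measurable_bounded_integrable _ _ mF') => //.
    have : (mu setT * mu setT < +oo)%E by rewrite (probability_setT mu) mule1
      ltry.
    by rewrite -(product_measure1E mu mu measurableT measurableT) setXTT; exact.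
  by exists (K * K); split; rewrite ?num_real// => D CD x _ /=; rewrite
    (le_trans (FK x))// ltW.
rewrite /fubini_F/=; under eq_integral => x _.
  rewrite (_ : (\int[mu]_y _)%E = 0%E); last first.
    transitivity (\int[mu]_y ((h x)%:E * (h y)%:E))%E; first by [].
    rewrite integralZl//; first by rewrite h0 mule0.
    exact: bounded_integrable hK.
  over.
by rewrite integral0.
Qed.

Let s n x := \sum_(0 <= j < n) h (X j x).

Let ms n : measurable_fun setT (s n).
Proof. by apply: measurable_sum => j; exact: measurableT_comp. Qed.

(** The off-diagonal terms vanish, and each of the [n] diagonal ones is at most [K ^+ 2]. *)
Let second_moment n : (\int[P]_x (s n x ^+ 2)%:E <= (K ^+ 2 * n%:R)%:E)%E.
Proof.
have hij i j : P.-integrable setT (fun x => (h (X i x) * h (X j x))%:E).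
  apply: (@bounded_integrable _ _ _ (fun x => h (X i x) * h (X j x)) (K * K)).
    by apply: measurable_funM; apply: measurableT_comp.
  by move=> x; rewrite normrM ler_pM.
under eq_integral => x _.
  rewrite expr2 /s mulr_suml -sumEFin.
  under eq_bigr do rewrite mulr_sumr -sumEFin.
  over.
rewrite integral_sum//; last by move=> i; apply: integrable_sum.
apply: (@le_trans _ _ (\sum_(0 <= i < n) (K ^+ 2)%:E)%E); last first.
  by rewrite sumEFin sumr_const_nat subn0 mulr_natr.
rewrite big_nat [leRHS]big_nat; apply: lee_sum => i /andP[_ iN].
rewrite integral_sum// (bigD1_seq i)/= ?iota_uniq ?mem_index_iota//.
rewrite [X in (_ + X)%E]big1 ?adde0; last by move=> j ji; rewrite
  uncorrelated// eq_sym.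
apply: (@le_trans _ _ (\int[P]_x (K ^+ 2)%:E)%E).
  apply: ge0_le_integral => //.
  - by move=> x _; rewrite lee_fin -expr2 sqr_ge0.
  - by apply/measurable_EFinP; apply: measurable_funM; apply: measurableT_comp.
  - by move=> x _; rewrite lee_fin -expr2 -[leLHS]real_normK ?num_real//
    ler_pXn2r ?nnegrE.
rewrite integral_cst// -[leRHS]mule1 -[X in (_ <= _ * X)%E](probability_setT P).
exact: lexx.
Qed.

(** Squared averages along the squares: the expectation is at most [K ^+ 2] divided by [k.+1 ^ 2],
    hence summable. The shift avoids a division by 0. *)
Let t k x := (s (k.+1 ^ 2) x / (k.+1 ^ 2)%:R) ^+ 2.

Let mt k : measurable_fun setT (EFin \o t k).
Proof.
by apply/measurable_EFinP; apply: measurable_funX; apply: measurable_funM.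
Qed.

Let sum_inv_square n : \sum_(0 <= k < n) (k.+1 ^ 2)%:R^-1 <= 2 :> R.
Proof.
case: n => [|n]; first by rewrite big_geq.
(* The sharper bound carries the induction, by [1 / (x + 1) ^ 2 <= 1 / x - 1 / (x + 1)]. *)
suff: \sum_(0 <= k < n.+1) (k.+1 ^ 2)%:R^-1 <= 2 - n.+1%:R^-1 :> R.
  by move/le_trans; apply; rewrite gerBl invr_ge0.
elim: n => [|n IH]; first by rewrite big_nat1 invr1; lra.
rewrite big_nat_recr//=; apply: le_trans (lerD IH (lexx _)) _.
rewrite -subr_ge0 natrX -[n.+2%:R]natr1; set x := n.+1%:R.
have x0 : 0 < x by rewrite /x.
have x10 : 0 < x + 1 by rewrite addr_gt0.
have -> : 2 - (x + 1)^-1 - (2 - x^-1 + (x + 1) ^- 2) = (x * (x + 1) ^+ 2)^-1.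
  by field; rewrite !gt_eqF.
by rewrite invr_ge0 mulr_ge0 ?(ltW x0) ?sqr_ge0.
Qed.

(** By monotone convergence the series has integral at most [K ^+ 2 * 2], so it is finite almost
    surely. *)
Let ae_square_sum : {ae P, forall x, (\sum_(0 <= k <oo) (t k x)%:E)%E \is a
  fin_num}.
Proof.
have f0 k x : (0 <= (t k x)%:E)%E by rewrite lee_fin sqr_ge0.
have : P.-integrable setT (fun x => \sum_(0 <= k <oo) (t k x)%:E)%E.
  apply/integrableP; split.
    apply: (ge0_emeasurable_sum (h := fun k x => (t k x)%:E) (P := xpredT)).
      by move=> k x _ _; exact: f0.
    by move=> k _; exact: mt.
  under eq_integral => x _ do rewrite gee0_abs ?nneseries_ge0//.
  rewrite integral_nneseries//.
  apply: (@le_lt_trans _ _ (K ^+ 2 * 2)%:E); last exact: ltry.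
  apply: lime_le; first by apply: is_cvg_nneseries => *; exact: integral_ge0.
  apply: nearW => n.
  apply: (@le_trans _ _ (\sum_(0 <= k < n) (K ^+ 2 * (k.+1 ^ 2)%:R^-1)%:E)%E).
    apply: lee_sum => k _.
    under eq_integral => x _ do rewrite /t exprMn mulrC EFinM.
    rewrite ge0_integralZl//.
    2: by apply/measurable_EFinP; exact: measurable_funX.
    2: by move=> x _; rewrite lee_fin sqr_ge0.
    have : (0 <= (((k.+1 ^ 2)%:R^-1 ^+ 2)%:E) :> \bar R)%E by rewrite lee_fin
      sqr_ge0.
    move=> /lee_wpmul2l/(_ _ _ (second_moment _)) /le_trans; apply.
    rewrite -EFinM lee_fin mulrCA ler_wpM2l ?sqr_ge0// expr2 -mulrA.
    by rewrite mulVf ?mulr1// pnatr_eq0.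
  by rewrite sumEFin lee_fin -mulr_sumr ler_wpM2l ?sqr_ge0.
by move=> /(integrable_ae measurableT); apply: filterS => x; apply.
Qed.

Lemma strong_law_centered : {ae P, forall x, forall eps : R, 0 < eps ->
  exists C : R, forall n, `|\sum_(0 <= j < n) h (X j x)| <= eps * n%:R + C}.
Proof.
apply: filterS ae_square_sum => x xfin.
have f0 k : (0 <= (t k x)%:E)%E by rewrite lee_fin sqr_ge0.
apply: sum_le_of_squares => [j|e e0]; first exact: hK.
(* The term [t k x] is dominated by the tail from [k], which tends to 0; this settles the averages
   along squares. *)
have tail : (\sum_(N <= k <oo) (t k x)%:E)%E @[N --> \oo] --> 0%E.
  apply: nneseries_tail_cvg => //.
  by rewrite -ge0_fin_numE// nneseries_ge0.
have [_ /cvgrPdist_lt] := (fine_cvgP _ _).1 tail.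
move=> /(_ _ (exprn_gt0 2 e0))[N _ HN].
exists N => k Nk; have /= := HN k Nk; rewrite sub0r normrN.
have tk : ((t k x)%:E <= \sum_(k <= j <oo) (t j x)%:E)%E.
  apply: le_trans (nneseries_lim_ge k.+1 _) => //.
  by rewrite big_nat1.
have tfin : (\sum_(k <= j <oo) (t j x)%:E)%E \is a fin_num.
  rewrite ge0_fin_numE ?nneseries_ge0//.
  apply: le_lt_trans (_ : (\sum_(0 <= j <oo) (t j x)%:E)%E < _)%E; last first.
    by rewrite -ge0_fin_numE// nneseries_ge0.
  rewrite [leRHS](nneseries_split 0 k)// add0n leeDr// sume_ge0//.
move=> /(le_lt_trans (ler_norm _)); rewrite -lte_fin fineK// => /(le_lt_trans
  tk).
rewrite lte_fin /t -[ltLHS]real_normK ?num_real// ltr_pXn2r ?nnegrE ?(ltW e0)//.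
rewrite normrM normfV (ger0_norm (ler0n _ _)) ltr_pdivrMr ?ltr0n// => /ltW.
exact.
Qed.

End Centered.

(** Pairwise independence is enough, as only second moments enter; subtracting the mean [m] reduces
    to the centered case. *)
Lemma strong_law (g : S -> R) (K : R) :
  measurable_fun setT g -> (forall x, `|g x| <= K) ->
  exists m : R, {ae P, forall x, forall eps : R, 0 < eps ->
    exists C : R, forall n,
      `|\sum_(0 <= j < n) g (X j x) - m * n%:R| <= eps * n%:R + C}.
Proof.
move=> mg gK; pose m := fine (\int[mu]_x (g x)%:E); exists m.
have gint : mu.-integrable setT (EFin \o g) by exact: bounded_integrable gK.
have cint : mu.-integrable setT (EFin \o cst m).
  by apply: (@bounded_integrable _ _ _ _ `|m|).
have h0 : (\int[mu]_x (g x - m)%:E = 0)%E.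
  under eq_integral do rewrite EFinB.
  rewrite integralB_EFin// integral_cst//.
  have -> : (m%:E * mu setT = m%:E)%E by rewrite (probability_setT mu) mule1.
  by rewrite /m fineK ?subee//; exact: integrable_fin_num.
have := @strong_law_centered (fun x => g x - m) (K + `|m|) _ _ h0.
have mh : measurable_fun setT (fun x => g x - m) by exact: measurable_funB.
move=> /(_ mh); have hK x : `|g x - m| <= K + `|m|.
  by rewrite (le_trans (ler_normB _ _))// lerD2r.
move=> /(_ hK); apply: filterS => x Hx e e0; have [C HC] := Hx e e0.
exists C => n; have := HC n; rewrite sumrB sumr_const_nat subn0.
by rewrite -[m *+ n]mulr_natr.
Qed.

End StrongLaw.

(** * Random homogeneous labellings *)

Lemma continuous_borel_measurable (R : realType) (T : ptopologicalType)
    (g : T -> R) :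
  continuous g -> measurable_fun [set: borel T] (g : borel T -> R).
Proof.
move=> /continuousP cg; apply: (measurability _ (RGenOInfty.measurableE R)).
move=> /= _ [_ [a ->]] <-; rewrite setTI; apply: sub_sigma_algebra.
exact/cg/interval_open.
Qed.

Lemma measurable_enorm (R : realType) (d : nat) d' (T : measurableType d')
    (D : set T) (g : T -> 'rV[R]_d) :
  (forall i, measurable_fun D (fun x => g x 0 i)) ->
  measurable_fun D (fun x => enorm (g x)).
Proof.
move=> mg; apply: (measurableT_comp (f := @Num.sqrt R)).
  by apply: continuous_measurable_fun; exact: sqrt_continuous.
by apply: measurable_sum => i; apply: measurable_funX.
Qed.

Section RandomLabelling.
Context (R : realType) (k M : nat) (Lam : set 'rV[R]_k) (l0 : Lam).
Context (mu : probability (borel (param_type l0)) R).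
Context (P : probability (tree M l0) R).
Hypothesis P_homogeneous : is_random_homogeneous mu P.
Let S := borel (param_type l0).
Let T := tree M l0.

Lemma measurable_label (v : node M) :
  measurable_fun [set: T] ((fun tau => tau v) : T -> S).
Proof.
apply: (@measurability _ _ T S setT _ (@open (param_type l0)) erefl).
move=> _ [B oB <-]; rewrite setTI; apply: sub_sigma_algebra.
by exists v, B.
Qed.

Lemma measurable_param_coord (i : 'I_k) :
  measurable_fun [set: S] ((fun l : param_type l0 => param_val l 0 i) : S -> R).
Proof.
apply: (@continuous_borel_measurable _ (param_type l0)) => l.
apply: (@continuous_comp _ _ _ (@param_val R k Lam l0) (fun x => x 0 i)).
  exact: initial_continuous.
exact: coord_continuous.
Qed.

(** Equality of two labels amounts to that of their [k] real coordinates, and there are countably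
    many pairs of nodes. *)
Lemma measurable_homogeneous : measurable (@homogeneous R k M Lam l0 : set T).
Proof.
pose G (p : node M * node M) : set T := if size p.1 == size p.2 then
  [set tau | tau p.1 = tau p.2] else setT.
have mG p : measurable (G p).
  rewrite /G; case: ifP => // _.
  rewrite [X in measurable X](_ : _ = \bigcap_(i in [set: 'I_k]) (setT `&`
    [set tau : T | param_val (tau p.1) 0 i == param_val (tau p.2) 0 i])).
    apply: fin_bigcap_measurable => // i _.
    have mc v : measurable_fun [set: T] (fun tau : T => param_val (tau v) 0 i).
      apply: (measurableT_comp (measurable_param_coord i)).
      exact: measurable_label.
    by have /(_ measurableT [set true]) := measurable_fun_eqr (mc p.1) (mc
      p.2); apply.
  apply/seteqP; split => tau /=; first by move=> e i _; split => //=; rewrite e.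
  move=> H; apply: val_inj; apply/rowP => i.
  by have [_ /eqP] := H i I.
rewrite [X in measurable X](_ : _ = \bigcap_(n in [set: nat])
   (if choice.unpickle n is Some p then G p else setT)).
  by apply: bigcapT_measurable => n; case: (choice.unpickle n).
apply/seteqP; split => tau /= H.
  move=> n _; case: (choice.unpickle n) => [p|]//; rewrite /G.
  by case: eqP => // /H.
move=> v w vw; have := H (choice.pickle (v, w)) I.
by rewrite choice.pickleK /G /= vw eqxx.
Qed.

Lemma P_homogeneous1 : P (@homogeneous R k M Lam l0) = 1%E.
Proof.
have := P_homogeneous (L := fset0) (O := fun=> setT) (fun _ _ => openT).
rewrite big_seq_fset0 => <-; congr (P _).
by apply/seteqP; split => tau //= [].
Qed.

Lemma P_setI_homogeneous (A : set T) : measurable A ->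
  P (@homogeneous R k M Lam l0 `&` A) = P A.
Proof.
move=> mA; have mH := measurable_homogeneous.
rewrite [RHS](measureDI P mA mH) setIC.
rewrite -[LHS]add0e; congr (_ + _)%E; apply/esym/eqP; rewrite -measure_le0;
  apply: (@le_trans _ _ (P (~` (@homogeneous R k M Lam l0)))).
  apply: le_measure; rewrite ?inE; [exact: measurableD|exact: measurableC|].
  by move=> tau [].
by rewrite probability_setC// P_homogeneous1 subee.
Qed.

Variable i0 : 'I_M.

(** On a homogeneous labelling, the common label of level [n], read at one fixed node so that it
    makes sense and is measurable everywhere. *)
Definition level_label n (tau : T) : S := tau (nseq n i0).

Let measurable_preimage_label n (A : set S) : measurable A ->
  measurable (level_label n @^-1` A).
Proof.
by move=> mA; rewrite -[X in measurable X]setTI; exact: (measurable_label (nseq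
  n i0)).
Qed.

Let indep_open i j (A B : set S) : i != j -> @open (param_type l0) A ->
  @open (param_type l0) B ->
  P (level_label i @^-1` A `&` level_label j @^-1` B) = (mu A * mu B)%E.
Proof.
move=> ij oA oB.
have mA : measurable A by exact: sub_sigma_algebra.
have mB : measurable B by exact: sub_sigma_algebra.
rewrite -P_setI_homogeneous; last by apply: measurableI; exact:
  measurable_preimage_label.
pose O n : set (param_type l0) := if n == i then A else B.
have oO n : n \in [fset i; j]%fset -> open (O n) by rewrite /O; case: ifP.
have := P_homogeneous oO.
rewrite big_fsetU1 ?inE//= big_seq_fset1 /O eqxx eq_sym (negbTE ij) => <-.
congr (P _); apply/seteqP; split => tau /= [h H]; split => //.
  move=> v; rewrite !inE => /orP[] /eqP vE; rewrite vE.
    by rewrite eqxx (h v (nseq i i0)) ?size_nseq//; case: H.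
  by rewrite eq_sym (negbTE ij) (h v (nseq j i0)) ?size_nseq//; case: H.
split.
  by have := H (nseq i i0); rewrite size_nseq !inE eqxx; apply.
by have := H (nseq j i0); rewrite size_nseq !inE eqxx orbT eq_sym (negbTE ij);
  apply.
Qed.

(** For fixed [B] both sides are finite measures in [A] which agree on the open sets, a generating
    pi-system. *)
Let indep_extend i j (B : set S) : measurable B ->
  (forall A, @open (param_type l0) A ->
    P (level_label i @^-1` A `&` level_label j @^-1` B) = (mu A * mu B)%E) ->
  forall A, measurable A ->
    P (level_label i @^-1` A `&` level_label j @^-1` B) = (mu A * mu B)%E.
Proof.
move=> mB HB A mA.
have mBj := measurable_preimage_label j mB.
have mi : measurable_fun [set: T] (level_label i) by exact: measurable_label.
have muB0 : 0 <= fine (mu B) by rewrite fine_ge0.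
pose m1 : {measure set S -> \bar R} := pushforward (mrestr P mBj) (level_label
  i).
pose m2 : {measure set S -> \bar R} := mscale (NngNum muB0) mu.
have muBE : mu B = (fine (mu B))%:E by rewrite fineK// fin_num_measure.
have m2E C : m2 C = (mu C * mu B)%E by rewrite /m2/= /mscale/= muBE muleC.
have : m1 mi A = m2 A; last by rewrite m2E.
apply: (@measure_unique _ R S (@open (param_type l0)) (fun=> setT) erefl
  _ _ _ (m1 mi) m2 _ _ A mA).
- by move=> ? ? ? ?; exact: openI.
- by move=> _; exact: openT.
- by rewrite bigcup_const.
- by move=> C oC; rewrite m2E -HB.
- move=> _; rewrite /m1/= /pushforward /mrestr preimage_setT setTI.
  by apply: le_lt_trans (probability_le1 P mBj) _; exact: ltry.
Qed.

Lemma level_label_indep i j (A B : set S) : i != j ->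
  measurable A -> measurable B ->
  P (level_label i @^-1` A `&` level_label j @^-1` B) = (mu A * mu B)%E.
Proof.
move=> ij mA mB; apply: indep_extend => // C oC.
rewrite setIC [RHS]muleC; apply: indep_extend => //.
  exact: sub_sigma_algebra.
by move=> D oD; apply: indep_open => //; rewrite eq_sym.
Qed.

Lemma ae_level_label (A : set S) : measurable A -> mu A = 0%E ->
  {ae P, forall tau, forall n, ~ A (level_label n tau)}.
Proof.
move=> mA A0; apply: ae_foralln => n; exists (level_label n @^-1` A); split.
- exact: measurable_preimage_label.
(* Independence from another level, taken with [B = setT], gives the law of a single label. *)
- have := @level_label_indep n n.+1 A setT; rewrite preimage_setT setIT A0
  mul0e.
  by apply => //; rewrite neq_ltn ltnSn.
- by move=> tau /= /contrapT.
Qed.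

End RandomLabelling.

(** * Measurability of the rates and reduction to Moran sets *)

Section RandomIFS.
Context (R : realType) (k d M : nat) (Lam : set 'rV[R]_k) (l0 : Lam).
Variables (I : rifs d M l0) (cmin cmax : R).
Hypotheses (cmin0 : 0 < cmin) (cmin_le_cmax : cmin <= cmax) (cmax1 : cmax < 1).
Let S := borel (param_type l0).

(* The rate is read off from one pair of points, hence measurable; clamping it
   to [cmin, cmax] makes it bounded also where [maps I l i] is irrelevant. *)
Definition similarity_ratio (l : S) (i : 'I_M) : R :=
  Num.max cmin (Num.min cmax
    (enorm (maps I l i (const_mx 1) - maps I l i 0) / enorm (const_mx 1 :
      'rV[R]_d))).

Lemma similarity_ratio_bounds l i : cmin <= similarity_ratio l i <= cmax.
Proof.
by rewrite /similarity_ratio le_max lexx/= ge_max cmin_le_cmax ge_min lexx.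
Qed.

Lemma similarity_ratioP l i c : cmin <= c -> c <= cmax ->
  is_similarity (maps I l i) c -> is_similarity (maps I l i) (similarity_ratio
    l i).
Proof.
move=> c1 c2 fc x y.
(* The norm vanishes only for [d = 0], where every ratio is correct. *)
have [e0|e0] := eqVneq (enorm (const_mx 1 : 'rV[R]_d)) 0.
  have z (u : 'rV[R]_d) : enorm u = 0.
    have c0 : (const_mx 1 : 'rV[R]_d) = 0 by apply/eqP; rewrite -enorm_eq0 e0.
    suff -> : u = 0 by rewrite enorm0.
    apply/rowP => j; have /rowP/(_ j) := c0; rewrite !mxE => /eqP.
    by rewrite oner_eq0.
  by rewrite !z mulr0.
rewrite fc /similarity_ratio fc subr0 mulfK//.
by rewrite min_r// max_r.
Qed.

Lemma measurable_ifs_size : measurable_fun [set: S] (nmaps I : S -> nat).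
Proof. exact: measurable_nmaps. Qed.

Let measurable_has_map (i : 'I_M) : measurable_fun [set: S] (fun l : S => (i <
  nmaps I l)%N).
Proof. exact: (measurable_fun_ltn _ measurable_ifs_size). Qed.

Let measurable_ratio (i : 'I_M) : measurable_fun ([set l | (i < nmaps I l)%N] :
  set S)
  (fun l : S => similarity_ratio l i).
Proof.
have mc (x : 'rV[R]_d) (j : 'I_d) :
    measurable_fun ([set l | (i < nmaps I l)%N] : set S) (fun l : S => maps I l
      i x 0 j).
  apply: (measurableT_comp (f := (fun x => x 0 j) : borel 'rV[R]_d -> R)).
    apply: (@continuous_borel_measurable _ 'rV[R]_d); exact: coord_continuous.
  exact: measurable_maps.
apply: measurable_maxr => //; apply: measurable_minr => //.
apply: measurable_funM => //; apply: measurable_enorm => j.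
rewrite (_ : (fun l => _) = (fun l : S => maps I l i (const_mx 1) 0 j) \-
    (fun l : S => maps I l i 0 0 j)).
  exact: measurable_funB.
by apply/funext => l; rewrite !mxE.
Qed.

Lemma measurable_ln_rate_sum s : measurable_fun [set: S]
  (fun l : S => ln (\sum_(i < M | (i < nmaps I l)%N) similarity_ratio l i `^
    s)).
Proof.
apply: (measurableT_comp (@measurable_ln R)).
(* The rate of index [i] is known to be measurable only where the map exists, hence the case
   distinction inside a sum over all [i]. *)
under eq_fun do rewrite big_mkcond.
apply: measurable_sum => i; apply: measurable_fun_if => //.
rewrite setTI.
apply: (measurableT_comp (f := @powR R ^~ s) (g := fun l : S =>
  similarity_ratio l i)).
  exact: measurable_powR.
exact: measurable_ratio.
Qed.

Lemma ln_rate_sum_bounded s : 0 <= s -> exists K : R, forall l : S,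
  `|ln (\sum_(i < M | (i < nmaps I l)%N) similarity_ratio l i `^ s)| <= K.
Proof.
move=> s0; exists (`|ln (cmin `^ s)| + `|ln M%:R|) => l.
(* An empty system gives an empty sum, and [ln 0 = 0] by convention. *)
have [l00|lN] := posnP (nmaps I l).
  by rewrite big_pred0 ?(ln0 (lexx 0)) ?normr0 ?addr_ge0// => i; rewrite l00.
(* Constant sequences, so that the bounds on [rate_sum] apply. *)
pose N (n : nat) := nmaps I l; pose c (n : nat) := similarity_ratio l.
have N0 n : (0 < N n <= M)%N by rewrite lN nmaps_le.
have cb n i : cmin <= c n i <= cmax by exact: similarity_ratio_bounds.
have S1 : cmin `^ s <= rate_sum N c s 0 := rate_sum_ge cmin0 cb N0 0 s0.
have S2 : rate_sum N c s 0 <= M%:R := rate_sum_le N cmin0 cmax1 cb 0 s0.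
have p0 : 0 < cmin `^ s by rewrite powR_gt0.
have S0 : 0 < rate_sum N c s 0 by exact: lt_le_trans S1.
rewrite -[X in `|ln X|]/(rate_sum N c s 0) ler_norml.
have := ler_norm (ln (M%:R : R)); have := ler_norm (- ln (cmin `^ s)).
rewrite normrN; have := normr_ge0 (ln (M%:R : R)); have := normr_ge0 (ln (cmin
  `^ s)).
have : ln (cmin `^ s) <= ln (rate_sum N c s 0) by rewrite ler_ln.
have : ln (rate_sum N c s 0) <= ln M%:R by rewrite ler_ln// posrE (lt_le_trans
  S0).
by move=> *; apply/andP; split; lra.
Qed.

Let word_map_label (tau : labelling M l0) (i0 : 'I_M) : homogeneous tau ->
  forall u v, node_map I tau u v =
    word_map (fun n => maps I (tau (nseq n i0))) (size u) v.
Proof.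
move=> h u v; elim: v u => //= i v IH u.
by rewrite IH size_rcons (h u (nseq (size u) i0)) ?size_nseq.
Qed.

Let admissible_label (tau : labelling M l0) (i0 : 'I_M) : homogeneous tau ->
  forall v, admissible I tau v <->
    word_ok (fun n => nmaps I (tau (nseq n i0))) 0 v.
Proof.
move=> h v.
(* Generalised over the node [u0] already reached, because labels are read at absolute positions in
   the tree. *)
suff H u0 : (forall u i w, v = u ++ i :: w -> (i < nmaps I (tau (u0 ++ u)))%N)
  <->
    word_ok (fun n => nmaps I (tau (nseq n i0))) (size u0) v.
  by have := H [::].
elim: v u0 => [|j v IH] u0 /=; first by split => // _ [].
have tauE u : tau u = tau (nseq (size u) i0) by apply: h; rewrite size_nseq.
split => [H|/andP[jN vok] [|i' u] i w /= [<- vE]].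
- apply/andP; split; first by have := H [::] j v erefl; rewrite cats0 tauE.
  have := IH (rcons u0 j); rewrite size_rcons => <- u i w vE.
  by rewrite cat_rcons; apply: (H (j :: u) i w); rewrite vE.
- by rewrite cats0 tauE.
- rewrite -cat_rcons; have := IH (rcons u0 j); rewrite size_rcons => -[_ H].
  exact: (H vok _ _ _ vE).
Qed.

Lemma attractor_homogeneous (tau : labelling M l0) (i0 : 'I_M) Delta :
  homogeneous tau -> attractor I Delta tau =
  moran_set (fun n => nmaps I (tau (nseq n i0)))
    (fun n => maps I (tau (nseq n i0))) Delta.
Proof.
move=> h; rewrite /attractor /moran_set; apply: eq_bigcapr => n _.
have -> : [set v : node M | size v = n /\ admissible I tau v] =
    [set v | size v = n /\ word_ok (fun n => nmaps I (tau (nseq n i0))) 0 v].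
  by apply/seteqP; split => v [vn /(admissible_label i0 h)].
by apply: eq_bigcupr => v _; rewrite (word_map_label i0 h).
Qed.

End RandomIFS.

Theorem theorem4p1 (R : realType) (k d M : nat) (Lam : set 'rV[R]_k)
    (l0 : Lam) (I : rifs d M l0)
    (mu : probability (borel (param_type l0)) R)
    (cmin cmax : R) (Delta : set 'rV[R]_d) (P : probability (tree M l0) R)
    (non_extinguishing : (1 < \int[mu]_l (nmaps I l)%:R%:E)%E)
    (I_uosc : uosc I)
    (cmin_gt0 : 0 < cmin) (cmin_le_cmax : cmin <= cmax) (cmax_lt1 : cmax < 1)
    (I_similarities : forall (l : param_type l0) (i : 'I_M), param_val l != 0 ->
      (i < nmaps I l)%N ->
      exists c : R, [/\ cmin <= c, c <= cmax & is_similarity (maps I l i) c])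
    (mu0 : mu [set l | param_val l = 0] = 0%E)
    (P_homogeneous : is_random_homogeneous mu P)
    (Delta_invariant : invariant_compact I Delta) :
  {ae P, forall tau, dim_qA (attractor I Delta tau) =
                     dim_H (attractor I Delta tau)}.
Proof.
pose S := borel (param_type l0).
pose Z : set S := [set l | param_val (l : param_type l0) = 0].
have mZ : measurable Z.
  rewrite [X in measurable X](_ : _ = \bigcap_(i in [set: 'I_k]) (setT `&`
      [set l : S | param_val (l : param_type l0) 0 i == 0])).
    apply: fin_bigcap_measurable => // i _.
    have m0 : measurable_fun [set: S] (fun=> 0 : R) by exact: measurable_cst.
    have := measurable_fun_eqr (@measurable_param_coord R k Lam l0 i) m0.
    by move=> /(_ measurableT [set true]); apply.
  apply/seteqP; split => l /=; first by move=> l_0 i _; split => //=; rewrite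
    l_0 mxE.
  by move=> H; apply/rowP => i; rewrite mxE; have [_ /eqP] := H i Logic.I.
(* As [mu] does not charge the parameter 0, another parameter exists; its nonempty system gives
   [0 < M] and thus the letter [i0]. *)
have [l1 l1Z] : exists l : S, param_val (l : param_type l0) != 0.
  apply/not_existsP => H; have : mu setT = 0%E.
    rewrite -mu0; congr (mu _); apply/seteqP; split => l // _ /=.
    by apply/eqP; have := H l; case: eqP.
  by rewrite probability_setT => /eqP; rewrite onee_eq0.
pose i0 : 'I_M := Ordinal (leq_trans (nmaps_gt0 I l1Z) (nmaps_le I l1)).
have [U [U0 U_open _ U_maps]] := I_uosc.
have [Delta0 Delta_compact Delta_maps] := Delta_invariant.
have mX n : measurable_fun setT (level_label i0 n : tree M l0 -> S).
  exact: measurable_label.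
pose q n : rat := odflt 0 (choice.unpickle n).
(* The sign condition stands after the existential, so that the means can be chosen for all [n] at
   once. *)
have law n : exists m : R, 0 <= ratr (q n) :> R ->
    {ae P, forall tau, forall eps : R, 0 < eps -> exists C : R, forall p,
      `|\sum_(0 <= j < p) ln (\sum_(i < M | (i < nmaps I (level_label i0 j
        tau))%N)
         similarity_ratio I cmin cmax (level_label i0 j tau) i `^ ratr (q n))
       - m * p%:R| <= eps * p%:R + C}.
  have [q0|q0] := pselect (0 <= ratr (q n) :> R); last by exists 0 => /q0.
  have [K HK] := ln_rate_sum_bounded I cmin_gt0 cmin_le_cmax cmax_lt1 q0.
  have [m Hm] := strong_law mX (level_label_indep P_homogeneous i0)
    (measurable_ln_rate_sum I cmin cmax (ratr (q n))) HK.
  by exists m.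
have [m Hm] := choice law.
have law_all : {ae P, forall tau, forall n, 0 <= ratr (q n) :> R ->
    forall eps : R, 0 < eps -> exists C : R, forall p,
      `|\sum_(0 <= j < p) ln (\sum_(i < M | (i < nmaps I (level_label i0 j
        tau))%N)
         similarity_ratio I cmin cmax (level_label i0 j tau) i `^ ratr (q n))
       - m n * p%:R| <= eps * p%:R + C}.
  apply: ae_foralln => n; have [q0|q0] := pselect (0 <= ratr (q n) :> R).
    by apply: filterS (Hm n q0) => tau Ht _.
  by apply: aeW => tau /q0.
have ae_hom : {ae P, forall tau, homogeneous (tau : labelling M l0)}.
  exists (~` (@homogeneous R k M Lam l0)); split.
  - by apply: measurableC; exact: measurable_homogeneous.
  - rewrite probability_setC; last exact: measurable_homogeneous.
    by rewrite (P_homogeneous1 P_homogeneous) subee.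
  - by [].
have ae_label := ae_level_label P_homogeneous i0 mZ mu0.
move: law_all ae_hom ae_label; apply: filterS3 => tau tau_law hom lab.
have labN n : param_val (level_label i0 n tau : param_type l0) != 0.
  by apply/eqP; exact: lab.
rewrite (attractor_homogeneous I i0 Delta hom).
(* The spectrum equals [dim_H] for every [delta > 0], so the limit is that of a constant. *)
apply: lim_near_cst => //; near=> delta.
have delta0 : 0 < delta by near: delta; exact: nbhs_right_gt.
pose c n : 'I_M -> R := similarity_ratio I cmin cmax (level_label i0 n tau).
apply: (@qA_spectrum_moran_set _ _ _ _ c _ _ _ cmin_gt0 cmax_lt1 _ _ _ _ _ _ _
  _ U0) => //.
- by move=> n i; exact: similarity_ratio_bounds.
- by move=> n; rewrite (nmaps_gt0 I (labN n)) nmaps_le.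
- move=> n i iN; have [e [e1 e2 fe]] := I_similarities _ _ (labN n) iN.
  exact: similarity_ratioP e1 e2 fe.
- by move=> n i iN; exact: Delta_maps.
- by move=> n i iN; have [+ _] := U_maps _ (labN n); apply.
- by move=> n i j iN jN; have [_ +] := U_maps _ (labN n); apply.
- move=> r r0; exists (m (choice.pickle r)) => e e0.
  have := tau_law (choice.pickle r); rewrite /q choice.pickleK /= => /(_ r0 e
    e0).
  exact.
Unshelve. all: by end_near. Qed.
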